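(* Fix a constant $N\ge 1$. Let a class of nominal combinatorial problems (P) $\min_{\boldsymbol{x}\in\mathcal{X}}\boldsymbol{c}\boldsymbol{x}$ be given, where $\mathcal{X}\subseteq\{0,1\}^n$ is the (non-empty) feasible set, and suppose that problems (P) of this class can be solved in polynomial time. Then the weighted robust problem (B-WRP) with $N$ budgeted uncertainty sets over feasible sets $\mathcal{X}$ of the same class can be solved in polynomial time, where (B-WRP) is \begin{align*} \min\ & \sum_{j\in[N]} p_j\Big(\sum_{i\in[n]} \underline{c}^j_i x_i + \Gamma^j\pi^j + \sum_{i\in[n]} \rho^j_i\Big)\\ \text{s.t. } & \pi^j + \rho^j_i \ge (\overline{c}^j_i - \underline{c}^j_i)x_i && \forall i\in[n],\ j\in[N],\\ & \pi^j\ge 0,\ \rho^j_i\ge 0 && \forall i\in[n],\ j\in[N],\\ & \boldsymbol{x}\in\mathcal{X}. \end{align*}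
   Context: Notation: $[n]=\{1,\dots,n\}$. The class of nominal problems is specified by a family of feasible sets $\mathcal{X}\subseteq\{0,1\}^n$ (given in some encoding, e.g. by a graph with source and sink) and a set of admissible cost vectors, which is either all of $\mathbb{Q}^n$ or all of $\mathbb{Q}^n_{\ge 0}$. ''(P) can be solved in polynomial time'' means that there is an algorithm that, given any $\mathcal{X}$ of the class and any admissible cost vector $\boldsymbol{c}$, returns an optimal solution in time polynomial in the input size. Weighted robust problem: given uncertainty sets $\mathcal{U}_1,\dots,\mathcal{U}_N$ and weights $p_1,\dots,p_N\ge 0$, the problem (WRP) is $\min_{\boldsymbol{x}\in\mathcal{X}}\sum_{j\in[N]}p_j\max_{\boldsymbol{c}\in\mathcal{U}_j}\boldsymbol{c}\boldsymbol{x}$. Budgeted uncertainty sets are $$\mathcal{U}_j=\Big\{\boldsymbol{c}: c_i=\underline{c}^j_i+z_i(\overline{c}^j_i-\underline{c}^j_i)\ (i\in[n]),\ \sum_{i\in[n]}z_i\le\Gamma^j,\ \boldsymbol{z}\in\{0,1\}^n\Big\}.$$ (B-WRP) is the mixed-integer formulation of (WRP) for these sets. An instance of (B-WRP) consists of $\mathcal{X}$ and rational data $p_j\ge 0$, $\Gamma^j\in\mathbb{Z}_{\ge 0}$, and vectors $\underline{\boldsymbol{c}}^j\le\overline{\boldsymbol{c}}^j$ (componentwise) for $j\in[N]$, where $\underline{\boldsymbol{c}}^j,\overline{\boldsymbol{c}}^j$ are admissible cost vectors. *)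

(* Defs.v *)
From mathcomp Require Import all_boot all_order all_algebra.

Set Implicit Arguments.
Unset Strict Implicit.
Unset Printing Implicit Defensive.

Import Order.TTheory GRing.Theory Num.Theory.
Local Open Scope ring_scope.

(** * Model of computation

    Jones's WHILE language: structured programs over binary trees.  Every
    operation is charged the size of the tree it produces (not one unit), so
    large trees cannot be built cheaply by sharing, and running times agree
    with those of Turing machines up to a polynomial. *)

Inductive tree : Type := Leaf | Node of tree & tree.

Fixpoint tree_size (t : tree) : nat :=
  if t is Node a b then (tree_size a + tree_size b).+1 else 1%N.

Definition tree_hd (t : tree) : tree := if t is Node a _ then a else Leaf.
Definition tree_tl (t : tree) : tree := if t is Node _ b then b else Leaf.

Inductive expr : Type :=
  | EVar of nat
  | ELeaf
  | ENode of expr & expr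
  | EHd of expr
  | ETl of expr.

Inductive cmd : Type :=
  | Skip
  | Assign of nat & expr
  | Seq of cmd & cmd
  | If of expr & cmd & cmd
  | While of expr & cmd.

Definition store : Type := nat -> tree.

Definition update (s : store) (v : nat) (t : tree) : store :=
  fun w => if w == v then t else s w.

Fixpoint eval (s : store) (e : expr) : tree :=
  match e with
  | EVar v => s v
  | ELeaf => Leaf
  | ENode a b => Node (eval s a) (eval s b)
  | EHd a => tree_hd (eval s a)
  | ETl a => tree_tl (eval s a)
  end.

Fixpoint expr_cost (s : store) (e : expr) : nat :=
  (tree_size (eval s e) +
   match e with
   | EVar _ | ELeaf => 0
   | ENode a b => expr_cost s a + expr_cost s b
   | EHd a | ETl a => expr_cost s a
   end)%N.

(** [exec c s k s']: started in store [s], the program [c] terminates in store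
    [s'] after time [k].  In tests, [Leaf] is false and every [Node] is true.
    The rules are deterministic. *)
Inductive exec : cmd -> store -> nat -> store -> Prop :=
  | exec_skip s : exec Skip s 1 s
  | exec_assign s v e :
      exec (Assign v e) s (expr_cost s e).+1 (update s v (eval s e))
  | exec_seq s s1 s2 c1 c2 k1 k2 :
      exec c1 s k1 s1 -> exec c2 s1 k2 s2 ->
      exec (Seq c1 c2) s (k1 + k2).+1 s2
  | exec_if_true s s1 e c1 c2 k :
      eval s e <> Leaf -> exec c1 s k s1 ->
      exec (If e c1 c2) s (expr_cost s e + k).+1 s1
  | exec_if_false s s1 e c1 c2 k :
      eval s e = Leaf -> exec c2 s k s1 ->
      exec (If e c1 c2) s (expr_cost s e + k).+1 s1
  | exec_while_done s e c :
      eval s e = Leaf -> exec (While e c) s (expr_cost s e).+1 s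
  | exec_while_step s s1 s2 e c k1 k2 :
      eval s e <> Leaf -> exec c s k1 s1 -> exec (While e c) s1 k2 s2 ->
      exec (While e c) s (expr_cost s e + k1 + k2).+1 s2.

(** Variable 0 holds the input initially and the output finally. *)
Definition init (t : tree) : store := update (fun=> Leaf) 0 t.

(** A computational problem is a type [I] of instances, with the codes of each
    instance and the outputs accepted as solutions of it. *)
Definition poly_time_solvable (I : Type)
    (code : I -> tree -> Prop) (solution : I -> tree -> Prop) : Prop :=
  exists (c : cmd) (p : {poly nat}), forall (i : I) (t : tree), code i t ->
    exists (k : nat) (s : store),
      [/\ exec c (init t) k s, (k <= p.[tree_size t])%N & solution i (s 0%N)].

(** * Encodings

    Numbers are in binary, least significant bit first; zeros in leading
    position and non-reduced fractions are allowed, in inputs and in outputs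
    alike. *)

Definition list_tree (ts : seq tree) : tree := foldr Node Leaf ts.

Definition bit_tree (b : bool) : tree := if b then Node Leaf Leaf else Leaf.

Definition bit_code (b : bool) (t : tree) : Prop := t = bit_tree b.

Fixpoint binary_value (s : seq bool) : nat :=
  if s is b :: s' then (b + (binary_value s').*2)%N else 0%N.

Definition nat_code (m : nat) (t : tree) : Prop :=
  exists2 s : seq bool, t = list_tree (map bit_tree s) & binary_value s = m.

Definition pair_code (P Q : tree -> Prop) (t : tree) : Prop :=
  exists a b : tree, [/\ t = Node a b, P a & Q b].

Definition int_code (z : int) (t : tree) : Prop :=
  exists (b : bool) (m : nat),
    z = (-1) ^+ b * m%:Z /\ pair_code (bit_code b) (nat_code m) t.

Definition rat_code (q : rat) (t : tree) : Prop :=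
  exists (a : int) (b : nat),
    [/\ (0 < b)%N, q = a%:~R / b%:R & pair_code (int_code a) (nat_code b) t].

Definition vec_code (n : nat) (P : 'I_n -> tree -> Prop) (t : tree) : Prop :=
  exists2 g : 'I_n -> tree,
    t = list_tree [seq g i | i <- enum 'I_n] & forall i, P i (g i).

(** * Nominal problems *)

(** [members] indexes the family of feasible sets, e.g. by graphs with a source
    and a sink; the admissible cost vectors are the nonnegative rational ones if
    [nonneg_costs], and all the rational ones otherwise. *)
Record nominal_class := NominalClass {
  members : Type;
  dim : members -> nat;
  feasible_set : forall X : members, {set {ffun 'I_(dim X) -> bool}};
  feasible_set_neq0 : forall X : members, feasible_set X != set0;
  encoding : members -> tree;
  nonneg_costs : bool
}.

Definition admissible (C : nominal_class) (n : nat) (c : 'I_n -> rat) : Prop :=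
  nonneg_costs C -> forall i, 0 <= c i.

Record nominal_instance (C : nominal_class) := NominalInstance {
  nom_set : members C;
  nom_cost : 'I_(dim nom_set) -> rat;
  nom_cost_admissible : admissible C nom_cost
}.
Arguments nom_cost {C} _ _.

Definition nominal_code (C : nominal_class) (I : nominal_instance C) :
    tree -> Prop :=
  pair_code (fun t => t = encoding (nom_set I))
            (vec_code (fun i => rat_code (nom_cost I i))).

Definition nominal_value (C : nominal_class) (I : nominal_instance C)
    (x : {ffun 'I_(dim (nom_set I)) -> bool}) : rat :=
  \sum_i nom_cost I i * (x i)%:R.
Arguments nominal_value {C} I x.

Definition nominal_optimal (C : nominal_class) (I : nominal_instance C)
    (x : {ffun 'I_(dim (nom_set I)) -> bool}) : Prop :=
  x \in feasible_set (nom_set I) /\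
  forall y, y \in feasible_set (nom_set I) ->
    nominal_value I x <= nominal_value I y.
Arguments nominal_optimal {C} I x.

Definition nominal_solution (C : nominal_class) (I : nominal_instance C)
    (t : tree) : Prop :=
  exists2 x : {ffun 'I_(dim (nom_set I)) -> bool},
    nominal_optimal I x & vec_code (fun i => bit_code (x i)) t.

(** * Weighted robust problem with [N] budgeted uncertainty sets *)

Record bwrp_instance (C : nominal_class) (N : nat) := BWRPInstance {
  rob_set : members C;
  weight : 'I_N -> rat;
  budget : 'I_N -> nat;
  cost_lo : 'I_N -> 'I_(dim rob_set) -> rat;
  cost_hi : 'I_N -> 'I_(dim rob_set) -> rat;
  weight_ge0 : forall j, 0 <= weight j;
  cost_lo_le_hi : forall j i, cost_lo j i <= cost_hi j i;
  cost_lo_admissible : forall j, admissible C (cost_lo j);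
  cost_hi_admissible : forall j, admissible C (cost_hi j)
}.
Arguments weight {C N} _ _.
Arguments budget {C N} _ _.
Arguments cost_lo {C N} _ _ _.
Arguments cost_hi {C N} _ _ _.

Definition bwrp_code (C : nominal_class) (N : nat) (I : bwrp_instance C N) :
    tree -> Prop :=
  pair_code (fun t => t = encoding (rob_set I))
    (vec_code (fun j =>
       pair_code (rat_code (weight I j))
      (pair_code (nat_code (budget I j))
      (pair_code (vec_code (fun i => rat_code (cost_lo I j i)))
                 (vec_code (fun i => rat_code (cost_hi I j i))))))).

Section BWRP.
Variables (R : realFieldType) (C : nominal_class) (N : nat).
Variable I : bwrp_instance C N.
Local Notation n := (dim (rob_set I)).

Definition bwrp_feasible (x : {ffun 'I_n -> bool})
    (pi : 'I_N -> R) (rho : 'I_N -> 'I_n -> R) : Prop :=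
  [/\ forall i j,
        ratr (cost_hi I j i - cost_lo I j i) * (x i)%:R <= pi j + rho j i,
      forall j, 0 <= pi j,
      forall i j, 0 <= rho j i
    & x \in feasible_set (rob_set I)].

Definition bwrp_value (x : {ffun 'I_n -> bool})
    (pi : 'I_N -> R) (rho : 'I_N -> 'I_n -> R) : R :=
  \sum_j ratr (weight I j) *
    (\sum_i ratr (cost_lo I j i) * (x i)%:R
     + (budget I j)%:R * pi j + \sum_i rho j i).

Definition bwrp_optimal (x : {ffun 'I_n -> bool})
    (pi : 'I_N -> R) (rho : 'I_N -> 'I_n -> R) : Prop :=
  bwrp_feasible x pi rho /\
  forall y pi' rho', bwrp_feasible y pi' rho' ->
    bwrp_value x pi rho <= bwrp_value y pi' rho'.

(** The output is rational, but it is optimal among all solutions with values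
    of the continuous variables in [R]. *)
Definition bwrp_solution (t : tree) : Prop :=
  exists (x : {ffun 'I_n -> bool})
         (pi : 'I_N -> rat) (rho : 'I_N -> 'I_n -> rat),
    bwrp_optimal x (fun j => ratr (pi j)) (fun j i => ratr (rho j i)) /\
    pair_code (vec_code (fun i => bit_code (x i)))
   (pair_code (vec_code (fun j => rat_code (pi j)))
              (vec_code (fun j => vec_code (fun i => rat_code (rho j i))))) t.

End BWRP.
Arguments bwrp_feasible {R C N} I x pi rho.
Arguments bwrp_value {R C N} I x pi rho.
Arguments bwrp_optimal {R C N} I x pi rho.

Definition nominal_poly_time (C : nominal_class) : Prop :=
  poly_time_solvable (@nominal_code C) (@nominal_solution C).

Definition bwrp_poly_time (R : realFieldType) (C : nominal_class) (N : nat) :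
    Prop :=
  poly_time_solvable (@bwrp_code C N) (@bwrp_solution R C N).

(* Main.v *)
Require Import Defs.
From mathcomp Require Import all_boot all_order all_algebra zify ring lra.

(** For fixed [x] the best [rho^j_i] is [max(0, d^j_i - pi^j) x_i], with [d] the
    difference of the cost bounds, and the objective is then a convex piecewise
    linear function of each [pi^j], so some optimal [pi^j] lies in
    [{0} U {d^j_1, ..., d^j_n}].  For each of the [(n+1)^N] choices of
    [(pi^1, ..., pi^N)] the remaining problem in [x] is nominal, with the
    admissible costs [sum_j p_j (lo^j_i + max(0, d^j_i - pi^j))]; the cheapest of
    the solutions found is optimal.

    Polynomial running times are obtained compositionally: [ptime f] says that
    some WHILE program computes the encoding of [f a] from that of [a] in
    polynomial time, and it is closed under composition, pairing, case
    distinction and folds whose accumulator stays of polynomial size.  Fractions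
    are never reduced: multiplying by a short number lengthens a number only
    additively, so the iterated sum keeps polynomial size. *)

(** The value [reduced_value p x] plays a double role. For every [p >= 0] it is attained by a
    feasible solution, and every feasible solution with 0-1 part [y] costs at least
    [reduced_value b y] for some breakpoint choice [b]. The breakpoints belonging to [y] are 0 or
    products of a deviation with [y i], so they lie in a rational set that is the same for all [y].
    Hence a rational output can be optimal even against continuous variables ranging over [R].

    On the computational side the obstacle is that the nominal solver is a program with a relational
    specification. It is known to behave well only from an initial store and only on codes of
    admissible instances, and it may return any optimum. The calculus of [ptime], in contrast, deals
    with functions whose programs run in arbitrary stores. Frame lemmas for programs settle the
    first mismatch, and types whose elements are solver runs settle the second. Correctness is
    accordingly proved for an arbitrary choice of nominal optima, one per candidate tuple. *)

Set Implicit Arguments.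
Unset Strict Implicit.
Unset Printing Implicit Defensive.

Import Order.TTheory GRing.Theory Num.Theory.

(** * Execution of WHILE programs *)

Lemma tree_size_gt0 t : 0 < tree_size t.
Proof. by case: t. Qed.
#[export] Hint Resolve tree_size_gt0 : core.

Lemma updateE s v t w : update s v t w = if w == v then t else s w.
Proof. by []. Qed.

(** With a single power of [n.+1] as the bound, products and compositions reduce to arithmetic on
    exponents. Sizes of trees are positive, and for [n > 0] the base is at least 2, so powers absorb
    constants and sums. *)
Definition polybound (b : nat -> nat) : Prop :=
  exists d, forall n, 0 < n -> b n <= n.+1 ^ d.

Lemma leq_polyexp n d e : d <= e -> n.+1 ^ d <= n.+1 ^ e.
Proof. exact: leq_pexp2l. Qed.

Lemma polybound_exp d : polybound (fun n => n.+1 ^ d).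
Proof. by exists d. Qed.

Lemma polybound_id : polybound (fun n => n).
Proof. by exists 1 => n _; rewrite expn1. Qed.

Lemma polybound_const k : polybound (fun=> k).
Proof.
exists k => n n0; apply: (@leq_trans (2 ^ k)); first exact/ltnW/ltn_expl.
by case: k => // k; rewrite leq_exp2r.
Qed.

Lemma polybound_mul b1 b2 :
  polybound b1 -> polybound b2 -> polybound (fun n => b1 n * b2 n).
Proof.
move=> [d1 h1] [d2 h2]; exists (d1 + d2) => n n0.
by rewrite expnD leq_mul ?h1 ?h2.
Qed.

Lemma polybound_add b1 b2 :
  polybound b1 -> polybound b2 -> polybound (fun n => b1 n + b2 n).
Proof.
move=> [d1 h1] [d2 h2]; exists (d1 + d2).+1 => n n0.
rewrite expnS -[_.+1 ^ (_ + _)]mul1n mulnA muln1.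
have /(leq_trans (h1 n n0)) l1 := @leq_polyexp n _ _ (leq_addr d2 d1).
have /(leq_trans (h2 n n0)) l2 := @leq_polyexp n _ _ (leq_addl d1 d2).
nia.
Qed.

Lemma polybound_comp_exp d b :
  polybound b -> polybound (fun n => (b n).+1 ^ d).
Proof.
move=> hb; have [e he] := polybound_add hb (polybound_const 1).
exists (e * d) => n n0; rewrite expnM.
case: d => // d; rewrite leq_exp2r //; have := he n n0; lia.
Qed.

Lemma polybound_leq b1 b2 :
  polybound b1 -> (forall n, 0 < n -> b2 n <= b1 n) -> polybound b2.
Proof. by move=> [d h] le; exists d => n n0; apply: leq_trans (h _ n0); apply: le. Qed.

Ltac polybound :=
  repeat first
    [ assumption
    | apply: polybound_const | apply: polybound_id
    | apply: polybound_exp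
    | apply: polybound_add | apply: polybound_mul | apply: polybound_comp_exp ].

(** A total-correctness triple with a time bound. As [K] is only an upper bound, the rules below can
    be generous: the one for [If] charges both branches. *)
Definition runs (c : cmd) (s : store) (K : nat) (P : store -> Prop) : Prop :=
  exists k s', [/\ exec c s k s', k <= K & P s'].

Lemma runs_weaken c s K K' (P Q : store -> Prop) :
  runs c s K P -> K <= K' -> (forall s', P s' -> Q s') -> runs c s K' Q.
Proof.
move=> [k [s' [ex le Ps']]] leK PQ; exists k, s'; split=> //.
  exact: leq_trans leK.
exact: PQ.
Qed.

Lemma runs_assign s v e K (Q : store -> Prop) :
  (expr_cost s e).+1 <= K -> Q (update s v (eval s e)) ->
  runs (Assign v e) s K Q.
Proof. by move=> le Qs; do 2 eexists; split; [exact: exec_assign| |]. Qed.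

Lemma runs_seq c1 c2 s K1 K2 K (P Q : store -> Prop) :
  runs c1 s K1 P -> (forall s1, P s1 -> runs c2 s1 K2 Q) ->
  (K1 + K2).+1 <= K -> runs (Seq c1 c2) s K Q.
Proof.
move=> [k1 [s1 [ex1 le1 Ps1]]] /(_ _ Ps1) [k2 [s2 [ex2 le2 Qs2]]] le.
exists (k1 + k2).+1, s2; split=> //; first exact: exec_seq ex1 ex2.
by apply: leq_trans le; rewrite ltnS leq_add.
Qed.

Lemma runs_if e c1 c2 s K1 K2 K (Q : store -> Prop) :
  (eval s e <> Leaf -> runs c1 s K1 Q) -> (eval s e = Leaf -> runs c2 s K2 Q) ->
  (expr_cost s e + (K1 + K2)).+1 <= K -> runs (If e c1 c2) s K Q.
Proof.
move=> h1 h2 le; case E: (eval s e) => [|a b].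
  have [k [s' [ex lek Qs']]] := h2 E.
  by do 2 eexists; split; [apply: exec_if_false ex| lia|].
have [|k [s' [ex lek Qs']]] := h1; first by rewrite E.
by do 2 eexists; split; [apply: exec_if_true ex; rewrite E| lia|].
Qed.

Lemma runs_while_done e c s K (Q : store -> Prop) :
  eval s e = Leaf -> (expr_cost s e).+1 <= K -> Q s -> runs (While e c) s K Q.
Proof. by move=> E le Qs; do 2 eexists; split; [exact: exec_while_done| |]. Qed.

Lemma runs_while_step e c s K1 K2 K (P Q : store -> Prop) :
  eval s e <> Leaf -> runs c s K1 P ->
  (forall s1, P s1 -> runs (While e c) s1 K2 Q) ->
  (expr_cost s e + K1 + K2).+1 <= K -> runs (While e c) s K Q.
Proof.
move=> E [k1 [s1 [ex1 le1 Ps1]]] /(_ _ Ps1) [k2 [s2 [ex2 le2 Qs2]]] le.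
do 2 eexists; split; [exact: exec_while_step ex1 ex2| lia | by []].
Qed.

Lemma expr_cost_size s e : tree_size (eval s e) <= expr_cost s e.
Proof. by case: e => /= *; lia. Qed.

(** Every operation is charged the size of the tree it builds, so time bounds growth. This is how a
    polynomial running time yields a polynomial output size. *)
Lemma exec_size c s k s' v :
  exec c s k s' -> tree_size (s' v) <= tree_size (s v) + k.
Proof.
elim=> {c s k s'} //=; try by move=> *; lia.
move=> s w e; rewrite updateE; case: eqP => _; last by lia.
by have := expr_cost_size s e; lia.
Qed.

(** * Locality: a program depends on, and changes, only its own variables *)

Fixpoint expr_below m (e : expr) : bool :=
  match e with
  | EVar v => v < m
  | ELeaf => true
  | ENode a b => expr_below m a && expr_below m b
  | EHd a | ETl a => expr_below m a
  end.

Fixpoint cmd_below m (c : cmd) : bool :=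
  match c with
  | Skip => true
  | Assign v e => (v < m) && expr_below m e
  | Seq a b => cmd_below m a && cmd_below m b
  | If e a b => [&& expr_below m e, cmd_below m a & cmd_below m b]
  | While e a => expr_below m e && cmd_below m a
  end.

Lemma expr_belowS m m' e : m <= m' -> expr_below m e -> expr_below m' e.
Proof.
move=> le; elim: e => //= [v|a IHa b IHb]; first by move=> h; exact: leq_trans le.
by move=> /andP[/IHa -> /IHb ->].
Qed.

Lemma cmd_belowS m m' c : m <= m' -> cmd_below m c -> cmd_below m' c.
Proof.
move=> le; have ES := expr_belowS le.
elim: c => //= [v e|a IHa b IHb|e a IHa b IHb|e a IHa].
- by move=> /andP[h /ES ->]; rewrite (leq_trans h).
- by move=> /andP[/IHa -> /IHb ->].
- by move=> /and3P[/ES -> /IHa -> /IHb ->].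
- by move=> /andP[/ES -> /IHa ->].
Qed.

Lemma expr_bound e : exists m, expr_below m e.
Proof.
elim: e => [v||a [m hm] b [m' hm']|a [m hm]|a [m hm]].
- by exists v.+1 => /=.
- by exists 0.
- exists (maxn m m'); rewrite /= (expr_belowS _ hm) ?(expr_belowS _ hm') //.
    exact: leq_maxr.
  exact: leq_maxl.
- by exists m.
- by exists m.
Qed.

Lemma cmd_bound c : exists m, cmd_below m c.
Proof.
elim: c => [|v e|a [m hm] b [m' hm']|e a [m hm] b [m' hm']|e a [m hm]].
- by exists 0.
- have [m hm] := expr_bound e.
  by exists (maxn v.+1 m); rewrite /= (expr_belowS _ hm) ?leq_maxl ?leq_maxr.
- exists (maxn m m'); rewrite /= (cmd_belowS _ hm) ?(cmd_belowS _ hm') //.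
    exact: leq_maxr.
  exact: leq_maxl.
- have [me hme] := expr_bound e; exists (maxn me (maxn m m')).
  by rewrite /= (expr_belowS _ hme) ?(cmd_belowS _ hm) ?(cmd_belowS _ hm') //; lia.
- have [me hme] := expr_bound e; exists (maxn me m).
  by rewrite /= (expr_belowS _ hme) ?(cmd_belowS _ hm) //; lia.
Qed.

Lemma expr_agree m s r e : (forall v, v < m -> r v = s v) -> expr_below m e ->
  eval r e = eval s e /\ expr_cost r e = expr_cost s e.
Proof.
move=> rs; elim: e => //= [v /rs -> //|a IHa b IHb|a IHa|a IHa].
- by move=> /andP[/IHa[-> ->] /IHb[-> ->]].
- by move=> /IHa[-> ->].
- by move=> /IHa[-> ->].
Qed.

(** Stores that agree on the variables of a program give the same values and costs to all its tests
    and assignments, so the run can be replayed step by step. *)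
Lemma exec_frame m c s k s' : exec c s k s' -> cmd_below m c ->
  forall r, (forall v, v < m -> r v = s v) ->
  exists r', [/\ exec c r k r', forall v, v < m -> r' v = s' v
    & forall v, m <= v -> r' v = r v].
Proof.
elim=> {c s k s'} /=.
- by move=> s _ r rs; exists r; split=> //; constructor.
- move=> s v e /andP[vm em] r rs; have [Ee Ec] := expr_agree rs em.
  exists (update r v (eval r e)); split.
  + by rewrite -Ec; constructor.
  + by move=> w wm; rewrite !updateE Ee rs.
  + by move=> w wm; rewrite updateE; case: eqP => // wv; lia.
- move=> s s1 s2 c1 c2 k1 k2 _ IH1 _ IH2 /andP[m1 m2] r rs.
  have [r1 [ex1 a1 f1]] := IH1 m1 r rs; have [r2 [ex2 a2 f2]] := IH2 m2 r1 a1.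
  exists r2; split=> //; first exact: exec_seq ex1 ex2.
  by move=> v mv; rewrite f2 // f1.
- move=> s s1 e c1 c2 k nE _ IH /and3P[em m1 _] r rs.
  have [Ee Ec] := expr_agree rs em; have [r1 [ex1 a1 f1]] := IH m1 r rs.
  by exists r1; split=> //; rewrite -Ec; apply: exec_if_true ex1; rewrite Ee.
- move=> s s1 e c1 c2 k nE _ IH /and3P[em _ m1] r rs.
  have [Ee Ec] := expr_agree rs em; have [r1 [ex1 a1 f1]] := IH m1 r rs.
  by exists r1; split=> //; rewrite -Ec; apply: exec_if_false ex1; rewrite Ee.
- move=> s e c nE /andP[em _] r rs; have [Ee Ec] := expr_agree rs em.
  by exists r; split=> //; rewrite -Ec; apply: exec_while_done; rewrite Ee.
- move=> s s1 s2 e c k1 k2 nE _ IH1 _ IH2 /[dup] ecm /andP[em m1] r rs.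
  have [Ee Ec] := expr_agree rs em; have [r1 [ex1 a1 f1]] := IH1 m1 r rs.
  have [r2 [ex2 a2 f2]] := IH2 ecm r1 a1.
  exists r2; split=> //; last by move=> v mv; rewrite f2 // f1.
  by rewrite -Ec; apply: exec_while_step ex1 ex2; rewrite Ee.
Qed.

(** Restores the situation of [init] on the variables below [m]; variable 0 is spared because it
    holds the input. *)
Fixpoint clear_vars (m : nat) : cmd :=
  if m is m'.+1 then
    if m' is 0 then Skip else Seq (Assign m' ELeaf) (clear_vars m')
  else Skip.

Lemma runs_clear_vars m s : runs (clear_vars m) s (m * 4 + 1)
  (fun s' => (forall v, v < m -> s' v = init (s 0) v) /\
             (forall v, m <= v -> s' v = s v)).
Proof.
elim: m s => [|[|m] IH] s.
- by exists 1, s; split=> //; constructor.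
- by exists 1, s; split=> //; [constructor|split=> // -[]].
apply: (@runs_seq _ _ _ 3 (m.+1 * 4 + 1) _ (fun s1 => s1 = update s m.+1 Leaf)).
- exact: runs_assign.
- move=> _ ->; apply: runs_weaken (IH _) (leqnn _) _ => s' [h1 h2]; split=> v mv.
  + case: (ltngtP v m.+1) mv => [vm _|mv|-> _]; last 2 first.
    * by rewrite ltnS leqNgt mv.
    * by rewrite h2 // !updateE eqxx.
    by rewrite h1 // /init !updateE.
  + by rewrite h2 ?updateE; [case: eqP => // ve; lia| lia].
- lia.
Qed.

(** Turns a guarantee about initial stores, the only kind available for the nominal solver, into one
    about a call in the midst of a larger program. *)
Lemma runs_frame m c s k s' : cmd_below m c -> exec c (init (s 0)) k s' ->
  runs (Seq (clear_vars m) c) s (m * 4 + k).+2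
    (fun r => (forall v, v < m -> r v = s' v) /\ (forall v, m <= v -> r v = s v)).
Proof.
move=> cm ex; apply: (runs_seq (K2 := k) (runs_clear_vars m s)).
- move=> s1 [h1 h2]; have [r [exr ar fr]] := exec_frame ex cm h1.
  exists k, r; split=> //; split=> // v mv; by rewrite fr // h2.
- lia.
Qed.

(** * Polynomial-time functions on encodable types *)

Class Enc (A : Type) := enc : A -> tree.
#[export] Hint Mode Enc ! : typeclass_instances.

#[export] Instance enc_tree : Enc tree := id.
#[export] Instance enc_bool : Enc bool := bit_tree.
#[export] Instance enc_pair {A B} `{Enc A} `{Enc B} : Enc (A * B) :=
  fun p => Node (enc p.1) (enc p.2).
#[export] Instance enc_seq {A} `{Enc A} : Enc (seq A) :=
  fun s => list_tree (map enc s).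
#[export] Instance enc_tuple {A n} `{Enc A} : Enc (n.-tuple A) :=
  fun s => enc (tval s).

Definition code_size {A} `{Enc A} (a : A) : nat := tree_size (enc a).

Lemma code_size_gt0 {A} `{Enc A} (a : A) : 0 < code_size a.
Proof. exact: tree_size_gt0. Qed.
#[export] Hint Resolve code_size_gt0 : core.

Lemma code_size_pair {A B} `{Enc A} `{Enc B} (a : A) (b : B) :
  code_size (a, b) = (code_size a + code_size b).+1.
Proof. by []. Qed.

Lemma code_size_cons {A} `{Enc A} (a : A) (s : seq A) :
  code_size (a :: s) = (code_size a + code_size s).+1.
Proof. by []. Qed.

Lemma code_size_cat {A} `{Enc A} (s t : seq A) :
  (code_size (s ++ t)).+1 = code_size s + code_size t.
Proof.
by elim: s => [|a s IH] //; rewrite cat_cons !code_size_cons; lia.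
Qed.

Lemma size_code_size {A} `{Enc A} (s : seq A) : (size s).*2 < code_size s.
Proof.
elim: s => // a s IH; rewrite code_size_cons /= doubleS.
by have: 0 < code_size a by []; lia.
Qed.

(** The program has to work in every store, whatever its scratch variables contain, and to leave the
    variables from [m] on alone. Programs can then be chained, and a caller can keep its own data
    above [m]. *)
Definition ptime {A B} `{Enc A} `{Enc B} (f : A -> B) : Prop :=
  exists c m d, forall (s : store) (a : A), s 0 = enc a ->
    runs c s ((code_size a).+1 ^ d)
      (fun s' => s' 0 = enc (f a) /\ forall v, m <= v -> s' v = s v).

Section Ptime.

Context {A B : Type} {EA : Enc A} {EB : Enc B}.

Lemma ptime_intro (f : A -> B) c m b : polybound b ->
  (forall (s : store) (a : A), s 0 = enc a ->
    runs c s (b (code_size a))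
      (fun s' => s' 0 = enc (f a) /\ forall v, m <= v -> s' v = s v)) ->
  ptime f.
Proof.
move=> [d hd] h; exists c, m, d => s a sa.
by apply: runs_weaken (h s a sa) (hd _ _) _.
Qed.

Lemma ptime_elim (f : A -> B) : ptime f ->
  exists c m d, forall m', m <= m' -> forall (s : store) (a : A), s 0 = enc a ->
    runs c s ((code_size a).+1 ^ d)
      (fun s' => s' 0 = enc (f a) /\ forall v, m' <= v -> s' v = s v).
Proof.
move=> [c [m [d h]]]; exists c, m, d => m' le s a /h r.
apply: runs_weaken r (leqnn _) _ => s' [-> fr]; split=> // v /(leq_trans le).
exact: fr.
Qed.

Lemma ptime_size (f : A -> B) : ptime f ->
  exists d, forall a, code_size (f a) <= (code_size a).+1 ^ d.
Proof.
move=> [c [m [d h]]].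
have [e he] := polybound_add polybound_id (polybound_exp d).
exists e => a; have [k [s' [ex le [E _]]]] := h (init (enc a)) a erefl.
rewrite /code_size -E; apply: leq_trans (exec_size 0 ex) (leq_trans _ (he _ _)) => //.
by rewrite /init updateE eqxx leq_add2l.
Qed.

(** Programs see only codes, so types with the same codes are interchangeable. This serves for
    tuples as lists, for typed lists as lists of trees, and for the types of runs that are encoded
    by their inputs. *)
Lemma ptime_recode {A' B'} {EA' : Enc A'} {EB' : Enc B'} (h : A' -> A)
    (f : A -> B) (g : A' -> B') :
  (forall a, enc (h a) = enc a) -> (forall a, enc (g a) = enc (f (h a))) ->
  ptime f -> ptime g.
Proof.
move=> Eh Eg [c [m [d H]]]; exists c, m, d => s a sa.
have := H s (h a); rewrite Eh => /(_ sa) r.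
rewrite /code_size -Eh; apply: runs_weaken r (leqnn _) _ => s' [-> fr].
by rewrite Eg.
Qed.

Lemma eq_ptime (f g : A -> B) : f =1 g -> ptime f -> ptime g.
Proof. by move=> fg; apply: (@ptime_recode _ _ _ _ id) => // a; rewrite fg. Qed.

End Ptime.

Ltac store_eq := rewrite ?updateE; repeat
  (match goal with |- context[?a == ?b] =>
     (have -> : (a == b) = false by apply/eqP; lia) ||
     (have -> : (a == b) = true by apply/eqP; lia) end).

Lemma ptime_id {A} {EA : Enc A} : ptime (fun a : A => a).
Proof. by exists Skip, 0, 0 => s a sa; exists 1, s; split=> //; constructor. Qed.

(** * Basic programs: literals, composition, pairing, case distinction *)

Fixpoint quote (t : tree) : expr :=
  if t is Node a b then ENode (quote a) (quote b) else ELeaf.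

Lemma eval_quote s t : eval s (quote t) = t.
Proof. by elim: t => //= a -> b ->. Qed.

Lemma expr_cost_quote s t : expr_cost s (quote t) = expr_cost (fun=> Leaf) (quote t).
Proof. by elim: t => //= a -> b ->; rewrite !eval_quote. Qed.

Lemma ptime_const {A B} {EA : Enc A} {EB : Enc B} (b : B) : ptime (fun _ : A => b).
Proof.
apply: (@ptime_intro _ _ _ _ _ (Assign 0 (quote (enc b))) 1 _
  (polybound_const (expr_cost (fun=> Leaf) (quote (enc b))).+1)) => s a _.
apply: runs_assign; first by rewrite expr_cost_quote.
by rewrite eval_quote; split=> // v v0; store_eq.
Qed.

Lemma ptime_comp {A B C} {EA : Enc A} {EB : Enc B} {EC : Enc C}
    (f : A -> B) (g : B -> C) :
  ptime f -> ptime g -> ptime (fun a => g (f a)).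
Proof.
move=> pf pg; have [e he] := ptime_size pf.
have [cf [mf [df hf]]] := ptime_elim pf; have [cg [mg [dg hg]]] := ptime_elim pg.
apply: (@ptime_intro _ _ _ _ _ (Seq cf cg) (maxn mf mg)
  (fun n => (n.+1 ^ df + (n.+1 ^ e).+1 ^ dg) + 1)); first by polybound.
move=> s a sa; apply: (runs_seq (K2 := ((code_size a).+1 ^ e).+1 ^ dg)
  (hf _ (leq_maxl mf mg) _ _ sa)).
- move=> s1 [s1a fr]; apply: runs_weaken (hg _ (leq_maxr mf _) _ _ s1a) _ _.
    case: (dg) => // d; rewrite leq_exp2r // ltnS; exact: he.
  by move=> s' [-> fr']; split=> // v mv; rewrite fr' // fr.
- by rewrite addn1.
Qed.

Lemma ptime_pair {A B C} {EA : Enc A} {EB : Enc B} {EC : Enc C}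
    (f : A -> B) (g : A -> C) :
  ptime f -> ptime g -> ptime (fun a => (f a, g a)).
Proof.
move=> pf pg; have [ef hef] := ptime_size pf; have [eg heg] := ptime_size pg.
have [cf [mf [df hf]]] := ptime_elim pf; have [cg [mg [dg hg]]] := ptime_elim pg.
(* The successor keeps [M] different from variable 0. Variable [M] saves the input while [cf] runs,
   and [M.+1] saves the first result while [cg] runs. *)
pose M := (maxn mf mg).+1.
apply: (@ptime_intro _ _ _ _ _
  (Seq (Assign M (EVar 0)) (Seq cf (Seq (Assign M.+1 (EVar 0))
  (Seq (Assign 0 (EVar M)) (Seq cg (Assign 0 (ENode (EVar M.+1) (EVar 0))))))))
  M.+2
  (fun n => n.+1 ^ df + n.+1 ^ dg + n.+1 ^ ef * 3 + n.+1 ^ eg * 3 + n * 2 + 20)).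
  by polybound.
move=> s a sa.
have szf := hef a; have szg := heg a; move: szf szg; rewrite /code_size => szf szg.
have mfM : mf <= M by lia.
have mgM : mg <= M by lia.
apply: (runs_seq (K1 := code_size a + 1)
  (P := fun s1 => s1 = update s M (enc a)) (K2 := _)).
- by apply: runs_assign; rewrite /= sa // /code_size; lia.
- move=> _ ->.
  apply: (runs_seq (hf _ mfM _ a _)); first by store_eq.
  + move=> s1 [s1a fr1].
    apply: (runs_seq (K1 := code_size (f a) + 1)
      (P := fun s2 => s2 = update s1 M.+1 (enc (f a)))).
    * by apply: runs_assign; rewrite /= s1a // /code_size; lia.
    * move=> _ ->.
      apply: (runs_seq (K1 := code_size a + 1)
        (P := fun s3 => s3 = update (update s1 M.+1 (enc (f a))) 0 (enc a))).
      -- by apply: runs_assign; rewrite /=; store_eq; rewrite fr1 //; store_eq;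
           rewrite // /code_size; lia.
      -- move=> _ ->.
         apply: (runs_seq (hg _ (leq_trans mgM (leqnSn M)) _ a _)); first by store_eq.
         ++ move=> s2 [s2a fr2].
            apply: (runs_assign (K := code_size (f a) * 2 + code_size (g a) * 2 + 2)).
              rewrite /= fr2 //; store_eq; rewrite s2a /code_size; lia.
            split; first by store_eq; rewrite /= s2a fr2 //; store_eq.
            move=> v vM; store_eq; rewrite fr2 //; last lia.
            store_eq; rewrite fr1 //; last lia.
            by store_eq.
         ++ exact: leqnn.
      -- exact: leqnn.
    * exact: leqnn.
  + exact: leqnn.
- rewrite /code_size; lia.
Qed.

Lemma ptime_if {A B} {EA : Enc A} {EB : Enc B} (b : A -> bool) (f g : A -> B) :
  ptime b -> ptime f -> ptime g -> ptime (fun a => if b a then f a else g a).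
Proof.
move=> pb pf pg.
have [eb heb] := ptime_size pb.
(* Pairing the test with the identity keeps the input, which a program for [b] alone would
   overwrite. *)
have [cb [mb [db hb]]] := ptime_elim (ptime_pair pb ptime_id).
have [cf [mf [df hf]]] := ptime_elim pf; have [cg [mg [dg hg]]] := ptime_elim pg.
pose M := (maxn mb (maxn mf mg)).+1.
apply: (@ptime_intro _ _ _ _ _
  (Seq cb (Seq (Assign M (EHd (EVar 0))) (Seq (Assign 0 (ETl (EVar 0)))
    (If (EVar M) cf cg)))) M.+1
  (fun n => n.+1 ^ db + n.+1 ^ df + n.+1 ^ dg + n.+1 ^ eb * 5 + n * 3 + 20)).
  by polybound.
move=> s a sa.
have szb := heb a; move: szb; rewrite /code_size => szb.
apply: (runs_seq (hb M _ _ a _)) => //; first lia.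
- move=> s1 [s1a fr1].
  apply: (runs_seq (K1 := code_size a + code_size (b a) * 2 + 2)
    (P := fun s2 => s2 = update s1 M (enc (b a)))).
  + by apply: runs_assign; rewrite /= s1a //= /code_size; lia.
  + move=> _ ->.
    apply: (runs_seq (K1 := code_size a * 2 + code_size (b a) + 2)
      (P := fun s2 => s2 = update (update s1 M (enc (b a))) 0 (enc a))).
    * by apply: runs_assign; rewrite /=; store_eq; rewrite /= s1a //= /code_size; lia.
    * move=> _ ->.
      apply: (runs_if (K1 := (code_size a).+1 ^ df) (K2 := (code_size a).+1 ^ dg)
        (K := code_size (b a) + ((code_size a).+1 ^ df + (code_size a).+1 ^ dg) + 1)).
      -- rewrite /=; store_eq; case: (b a) => //= _.
         apply: (runs_weaken (hf M _ _ a _)) => //; first lia.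
         move=> s' [-> fr]; split=> // v vM; rewrite fr; last lia.
         by store_eq; rewrite fr1 //; lia.
      -- rewrite /=; store_eq; case: (b a) => //= _.
         apply: (runs_weaken (hg M _ _ a _)) => //; first lia.
         move=> s' [-> fr]; split=> // v vM; rewrite fr; last lia.
         by store_eq; rewrite fr1 //; lia.
      -- by rewrite /=; store_eq; rewrite /code_size; lia.
    * exact: leqnn.
  + exact: leqnn.
- rewrite /code_size; lia.
Qed.

Lemma ptime_assign {A B} {EA : Enc A} {EB : Enc B} (e : expr) (f : A -> B) b :
  polybound b ->
  (forall (s : store) a, s 0 = enc a ->
     eval s e = enc (f a) /\ expr_cost s e <= b (code_size a)) ->
  ptime f.
Proof.
move=> pb h; apply: (@ptime_intro _ _ _ _ _ (Assign 0 e) 1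
  (fun n => b n + 1)); first by polybound.
move=> s a /h [E c]; apply: runs_assign; first by rewrite addn1.
by split=> // v v0; store_eq.
Qed.

Section PtimeData.

Context {A B C X : Type} {EA : Enc A} {EB : Enc B} {EC : Enc C} {EX : Enc X}.

Lemma ptime_fst (f : A -> B * C) : ptime f -> ptime (fun a => (f a).1).
Proof.
move=> pf; apply: (ptime_comp pf).
apply: (@ptime_assign _ _ _ _ (EHd (EVar 0)) _ (fun n => n * 3)); first by polybound.
move=> s a /= ->; split=> //=; rewrite /code_size /=; lia.
Qed.

Lemma ptime_snd (f : A -> B * C) : ptime f -> ptime (fun a => (f a).2).
Proof.
move=> pf; apply: (ptime_comp pf).
apply: (@ptime_assign _ _ _ _ (ETl (EVar 0)) _ (fun n => n * 3)); first by polybound.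
move=> s a /= ->; split=> //=; rewrite /code_size /=; lia.
Qed.

Lemma ptime_cons (f : A -> X) (g : A -> seq X) :
  ptime f -> ptime g -> ptime (fun a => f a :: g a).
Proof.
move=> pf pg; apply: (ptime_recode (h := id) (f := fun a => (f a, g a))) => //.
exact: ptime_pair.
Qed.

Lemma ptime_behead (f : A -> seq X) : ptime f -> ptime (fun a => behead (f a)).
Proof.
move=> pf; apply: (ptime_comp pf).
apply: (@ptime_assign _ _ _ _ (ETl (EVar 0)) _ (fun n => n * 3)); first by polybound.
move=> s a /= ->; case: a => [|x l]; split=> //=; rewrite /code_size /=; lia.
Qed.


End PtimeData.

(** Expressions have no conditionals, so a function that treats the empty list separately is
    compiled into a test on the code of the list. The bound [b 1] appears because the empty list has
    a code of size 1. *)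
Lemma ptime_match {A B X} {EA : Enc A} {EB : Enc B} {EX : Enc X}
    (f : seq X -> B) (e1 e2 : expr) (l : A -> seq X) b :
  polybound b -> ptime l ->
  (forall (s : store), s 0 = Leaf ->
     eval s e1 = enc (f [::]) /\ expr_cost s e1 <= b 1) ->
  (forall (s : store) x r, s 0 = enc (x :: r) ->
     eval s e2 = enc (f (x :: r)) /\ expr_cost s e2 <= b (code_size (x :: r))) ->
  ptime (fun a => f (l a)).
Proof.
move=> pb pl h1 h2; apply: (ptime_comp pl).
apply: (@ptime_intro _ _ _ _ _ (If (EVar 0) (Assign 0 e2) (Assign 0 e1)) 1
  (fun n => n + b n * 2 + 10)); first by polybound.
move=> s a sa.
apply: (runs_if (K1 := b (code_size a) + 1) (K2 := b (code_size a) + 1)); rewrite /= sa.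
- case: a sa => // x r /h2[E c] _; apply: runs_assign; first by rewrite addn1.
  by split=> // v v0; store_eq.
- case: a sa => // /h1[E c] _; apply: runs_assign; first by rewrite addn1.
  by split=> // v v0; store_eq.
- rewrite /code_size; lia.
Qed.

Lemma ptime_nilp {A X} {EA : Enc A} {EX : Enc X} (l : A -> seq X) :
  ptime l -> ptime (fun a => nilp (l a)).
Proof.
move=> pl; apply: (@ptime_match _ _ _ _ _ _ (@nilp X) (ENode ELeaf ELeaf) ELeaf _
  (fun=> 5)) => //.
exact: polybound_const.
Qed.

Lemma ptime_head {A X} {EA : Enc A} {EX : Enc X} (x0 : X) (l : A -> seq X) :
  ptime l -> ptime (fun a => head x0 (l a)).
Proof.
move=> pl; pose c : nat := expr_cost (fun=> Leaf) (quote (EX x0)).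
apply: (@ptime_match _ _ _ _ _ _ (head x0) (quote (EX x0))
  (EHd (EVar 0)) _ (fun n => c + n * 3)) => //.
- by polybound.
- by move=> s _; rewrite eval_quote expr_cost_quote; split=> //; lia.
- move=> s x r /= ->; split=> //=; rewrite /code_size /=; lia.
Qed.

Lemma code_size_prefix {X} {EX : Enc X} (r1 r2 : seq X) :
  code_size r1 <= code_size (r1 ++ r2).
Proof. have := @code_size_cat _ EX r1 r2; have: 0 < code_size r2 by []; lia. Qed.

(** * Loops over lists *)

Section Foldl.

Context {A S X : Type} {EA : Enc A} {ES : Enc S} {EX : Enc X}.
Variables (f : A -> S -> X -> S) (s0 : A -> S) (l : A -> seq X).

(** Loop invariant: variables [M], [M.+1] and [M.+2] hold the context, the accumulator and the
    remaining list. [Q] bounds every intermediate accumulator and [L] the list, so one bound serves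
    for all iterations. *)
Lemma runs_foldl_loop c m d M a Q L : m <= M -> 0 < M ->
  (forall (s : store) (p : A * (S * X)), s 0 = enc p ->
    runs c s ((code_size p).+1 ^ d)
      (fun s' => s' 0 = enc (f p.1 p.2.1 p.2.2) /\
                 forall v, m <= v -> s' v = s v)) ->
  forall r acc (s : store),
    s M = enc a -> s M.+1 = enc acc -> s M.+2 = enc r ->
    (forall r1 r2, r = r1 ++ r2 -> code_size (foldl (f a) acc r1) <= Q) ->
    code_size r <= L ->
    runs (While (EVar M.+2)
      (Seq (Assign 0 (ENode (EVar M) (ENode (EVar M.+1) (EHd (EVar M.+2)))))
      (Seq c (Seq (Assign M.+1 (EVar 0)) (Assign M.+2 (ETl (EVar M.+2)))))))
      s (code_size r * ((code_size a + Q + L + 2).+1 ^ d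
                  + (code_size a + Q + L) * 12 + 20))
      (fun s' => s' M.+1 = enc (foldl (f a) acc r) /\
                 forall v, M.+3 <= v -> s' v = s v).
Proof.
move=> mM M0 hc; elim=> [|x r IH] acc s sa sacc sr hQ hL; last first.
  have {}sr : s M.+2 = Node (enc x) (enc r) by [].
  have Q1 : code_size acc <= Q by apply: (hQ [::] (x :: r)).
  have Q2 : code_size (f a acc x) <= Q by apply: (hQ [:: x] r).
  move: hL; rewrite code_size_cons => hL.
  set T := (_ ^ d + _ + _).
  have hrec : forall s1 : store, (s1 M = enc a /\ s1 M.+1 = enc (f a acc x) /\
      s1 M.+2 = enc r /\ forall v, M.+3 <= v -> s1 v = s v) ->
      runs (While (EVar M.+2)
        (Seq (Assign 0 (ENode (EVar M) (ENode (EVar M.+1) (EHd (EVar M.+2)))))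
        (Seq c (Seq (Assign M.+1 (EVar 0)) (Assign M.+2 (ETl (EVar M.+2)))))))
        s1 (code_size r * T) (fun s' => s' M.+1 = enc (foldl (f a) acc (x :: r)) /\
                   forall v, M.+3 <= v -> s' v = s v).
    move=> s1 [e1 [e2 [e3 fr]]].
    apply: (runs_weaken (IH (f a acc x) s1 e1 e2 e3 _ _)) => //.
    - by move=> r1 r2 E; apply: (hQ (x :: r1) r2); rewrite E.
    - lia.
    - by move=> s' [-> fr']; split=> // v Mv; rewrite fr' // fr.
  (* Each iteration removes at least one unit of [code_size r] and may thus spend [T]; the part
     withheld here covers the loop test. *)
  apply: (runs_while_step _ _ hrec (K1 := T - L * 2 - 3)).
  - by rewrite /= sr.
  - apply: (runs_seq (K1 := (code_size a + code_size acc + L) * 6 + 6)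
      (P := fun s1 => s1 = update s 0 (enc (a, (acc, x))))
      (K2 := (code_size a + Q + L + 2).+1 ^ d + Q + L * 3 + 7)).
    + apply: runs_assign; rewrite /= sa sacc sr //=.
      by move: hL; rewrite /code_size /=; lia.
    + move=> _ ->.
      apply: (runs_seq (hc _ (a, (acc, x)) _) (K2 := Q + L * 3 + 5)) => //.
      * move=> s1 [/= s1a fr1].
        apply: (runs_seq (P := fun s2 => s2 = update s1 M.+1 (enc (f a acc x)))
          (K1 := Q + 1) (K2 := L * 3 + 2)).
        -- by apply: runs_assign; rewrite /= s1a // addn1 ltnS addn0.
        -- move=> _ ->; apply: runs_assign.
             rewrite /=; store_eq; rewrite fr1; last lia.
             by store_eq; rewrite sr /=; move: hL; rewrite /code_size /=; lia.
           rewrite /=; store_eq; rewrite !fr1; try lia.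
           store_eq; rewrite sr; do 3 split=> //.
           by move=> v vM; store_eq; rewrite fr1; last lia; store_eq.
        -- lia.
      * rewrite !code_size_pair.
        have : ((code_size a + (code_size acc + code_size x).+1).+1).+1 ^ d <=
               (code_size a + Q + L + 2).+1 ^ d.
          by case: (d) => // e; rewrite leq_exp2r //; lia.
        lia.
    + rewrite /T; lia.
  - rewrite /= sr /T /code_size /= -/(code_size x) -/(code_size r); nia.
apply: runs_while_done; rewrite /= ?sr //=.
by have -> : code_size ([::] : seq X) = 1 by []; lia.
Qed.

(** A step that doubles its accumulator is polynomial, but its iteration is not; hence the bound on
    the accumulators reached after all prefixes of the list. *)
Lemma ptime_foldl b : polybound b ->
  ptime (fun p : A * (S * X) => f p.1 p.2.1 p.2.2) -> ptime s0 -> ptime l ->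
  (forall a r1 r2, l a = r1 ++ r2 ->
     code_size (foldl (f a) (s0 a) r1) <= b (code_size a)) ->
  ptime (fun a => foldl (f a) (s0 a) (l a)).
Proof.
move=> [e he] pf ps pl hb.
have [cf [mf [df hf]]] := ptime_elim pf.
have [cp [mp [dp hp]]] := ptime_elim (ptime_pair ptime_id (ptime_pair ps pl)).
have [el hel] := ptime_size pl; have [es hes] := ptime_size ps.
pose M := (maxn mf mp).+1.
apply: (@ptime_intro _ _ _ _ _
  (Seq cp (Seq (Assign M (EHd (EVar 0))) (Seq (Assign M.+1 (EHd (ETl (EVar 0))))
    (Seq (Assign M.+2 (ETl (ETl (EVar 0))))
    (Seq (While (EVar M.+2)
      (Seq (Assign 0 (ENode (EVar M) (ENode (EVar M.+1) (EHd (EVar M.+2)))))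
      (Seq cf (Seq (Assign M.+1 (EVar 0)) (Assign M.+2 (ETl (EVar M.+2)))))))
      (Assign 0 (EVar M.+1))))))) M.+3
  (fun n => n.+1 ^ dp + (n + n.+1 ^ es + n.+1 ^ el) * 20 + n.+1 ^ e + 100
    + n.+1 ^ el * ((n + n.+1 ^ e + n.+1 ^ el + 2).+1 ^ df
                  + (n + n.+1 ^ e + n.+1 ^ el) * 12 + 20))).
  by polybound.
move=> s a sa; have szl := hel a; have szs := hes a.
set n := code_size a in szl szs *.
apply: (runs_seq (hp M _ _ a _)) => //; first lia.
- move=> s1 [s1a fr1].
  apply: (runs_seq (K1 := n * 2 + code_size (s0 a) + code_size (l a) + 10)
    (P := fun s2 => s2 = update s1 M (enc a))).
    by apply: runs_assign; rewrite /= s1a //= /n /code_size /=; lia.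
  move=> _ ->.
  apply: (runs_seq (K1 := n * 2 + code_size (s0 a) * 3 + code_size (l a) * 3 + 10)
    (P := fun s2 => s2 = update (update s1 M (enc a)) M.+1 (enc (s0 a)))).
    by apply: runs_assign; rewrite /=; store_eq; rewrite s1a //= /n /code_size /=; lia.
  move=> _ ->.
  apply: (runs_seq (K1 := n * 2 + code_size (s0 a) * 3 + code_size (l a) * 3 + 10)
    (P := fun s2 => s2 = update (update (update s1 M (enc a)) M.+1 (enc (s0 a)))
       M.+2 (enc (l a)))).
    by apply: runs_assign; rewrite /=; store_eq; rewrite s1a //= /n /code_size /=; lia.
  move=> _ ->.
  apply: (runs_seq (@runs_foldl_loop cf M df M a (n.+1 ^ e) (n.+1 ^ el) _ _ _
     (l a) (s0 a) _ _ _ _ _ _)) => //.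
  + by move=> s2 p s2p; apply: hf => //; lia.
  + by store_eq.
  + by store_eq.
  + by store_eq.
  + by move=> r1 r2 /hb h; apply: leq_trans h (he _ _).
  + move=> s2 [s2a fr2].
    apply: (runs_assign (K := n.+1 ^ e + 2)).
      have h : code_size (foldl (f a) (s0 a) (l a)) <= n.+1 ^ e.
        by apply: leq_trans (hb a (l a) [::] _) (he _ _) => //; rewrite cats0.
      by rewrite /= s2a; move: h; rewrite /code_size; lia.
    rewrite /=; store_eq; split=> // v vM; store_eq.
    rewrite fr2 //; store_eq; rewrite fr1 //; lia.
  + exact: leqnn.
  + exact: leqnn.
  + exact: leqnn.
- have : code_size (l a) * ((n + n.+1 ^ e + n.+1 ^ el + 2).+1 ^ df
                  + (n + n.+1 ^ e + n.+1 ^ el) * 12 + 20) <=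
         n.+1 ^ el * ((n + n.+1 ^ e + n.+1 ^ el + 2).+1 ^ df
                  + (n + n.+1 ^ e + n.+1 ^ el) * 12 + 20).
    by rewrite leq_mul2r szl orbT.
  rewrite -/n; lia.
Qed.

(** If each step adds to [mu] an amount independent of the accumulator, the total growth is at most
    the number of steps times the largest increment. Allowing [mu] to differ from the size within
    linear factors makes it possible to count bits, since the codes of the two bits differ in
    size. *)
Lemma ptime_foldl_measure (mu : S -> nat) K d :
  ptime (fun p : A * (S * X) => f p.1 p.2.1 p.2.2) -> ptime s0 -> ptime l ->
  (forall s, code_size s <= K * mu s + K) ->
  (forall s, mu s <= K * code_size s) ->
  (forall a s x, mu (f a s x) <= mu s + (code_size a + code_size x).+1 ^ d) ->
  ptime (fun a => foldl (f a) (s0 a) (l a)).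
Proof.
move=> pf ps pl hK hmu hstep.
have [el hel] := ptime_size pl; have [es hes] := ptime_size ps.
apply: (@ptime_foldl (fun n => K * (K * n.+1 ^ es
   + n.+1 ^ el * (n + n.+1 ^ el).+1 ^ d) + K)) => //.
  by polybound.
move=> a r1 r2 E; apply: leq_trans (hK _) _.
rewrite leq_add2r leq_mul2l; apply/orP; right.
have hr : code_size r1 <= (code_size a).+1 ^ el.
  by apply: leq_trans (hel a); rewrite E code_size_prefix.
have h t : mu (foldl (f a) t r1) <=
    mu t + code_size r1 * (code_size a + (code_size a).+1 ^ el).+1 ^ d.
  elim: r1 hr t {E} => [|x r1 IH] hr t /=; first by rewrite leq_addr.
  move: hr; rewrite code_size_cons => hr.
  apply: leq_trans (IH _ _) _; first lia.
  have := hstep a t x.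
  have : (code_size a + code_size x).+1 ^ d <=
         (code_size a + (code_size a).+1 ^ el).+1 ^ d.
    by case: (d) => // d'; rewrite leq_exp2r //; lia.
  nia.
apply: leq_trans (h _) _; apply: leq_add.
  by apply: leq_trans (hmu _) _; rewrite leq_mul2l hes orbT.
by rewrite leq_mul2r hr orbT.
Qed.

End Foldl.

(** * List functions as folds *)

Section PtimeSeq.

Context {A B X Y S : Type} {EA : Enc A} {EB : Enc B} {EX : Enc X} {EY : Enc Y}
  {ES : Enc S}.

Lemma ptime_comp2 (g : X -> Y -> B) (f1 : A -> X) (f2 : A -> Y) :
  ptime (fun p : X * Y => g p.1 p.2) -> ptime f1 -> ptime f2 ->
  ptime (fun a => g (f1 a) (f2 a)).
Proof. by move=> pg p1 p2; apply: (ptime_comp (ptime_pair p1 p2) pg). Qed.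

Lemma ptime_catrev (f g : A -> seq X) :
  ptime f -> ptime g -> ptime (fun a => catrev (f a) (g a)).
Proof.
move=> pf pg; apply: (eq_ptime (f := fun a => foldl (fun o x => x :: o) (g a) (f a))).
  move=> a; elim: (f a) (g a) => //= x s IH t; exact: IH.
apply: (@ptime_foldl_measure _ _ _ _ _ _ (fun _ o x => x :: o) _ _ code_size 1 1) => //.
- apply: ptime_cons; first exact/ptime_snd/ptime_snd/ptime_id.
  exact/ptime_fst/ptime_snd/ptime_id.
- by move=> s; lia.
- by move=> s; lia.
- by move=> a s x; rewrite code_size_cons; lia.
Qed.

Lemma ptime_rev (f : A -> seq X) : ptime f -> ptime (fun a => rev (f a)).
Proof. by move=> pf; apply: ptime_catrev => //; apply: ptime_const. Qed.

End PtimeSeq.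

Lemma ptime_map {A X Y} {EA : Enc A} {EX : Enc X} {EY : Enc Y}
    (f : A -> X -> Y) (l : A -> seq X) :
  ptime (fun p : A * X => f p.1 p.2) -> ptime l ->
  ptime (fun a => [seq f a x | x <- l a]).
Proof.
move=> pf pl; apply: (eq_ptime (f := fun a =>
  rev (foldl (fun o x => f a x :: o) [::] (l a)))) => [a|].
  rewrite -[[seq _ | _ <- _]]revK -map_rev; congr rev.
  by rewrite -[in LHS](revK (l a)) foldl_rev; elim: (rev (l a)) => //= x s ->.
apply: ptime_rev; have [e he] := ptime_size pf.
have [d hd] : polybound (fun n => n.+1.+1 ^ e + 1).
  apply: polybound_add; last exact: polybound_const.
  apply: polybound_comp_exp.
  by apply: (@polybound_leq (fun n => n + 1)); [polybound| move=> n; lia].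
apply: (@ptime_foldl_measure _ _ _ _ _ _ (fun a o x => f a x :: o) _ _
  code_size 1 d) => //.
- apply: ptime_cons; last exact/ptime_fst/ptime_snd/ptime_id.
  apply: (ptime_comp (f := fun p : A * (seq Y * X) => (p.1, p.2.2)) _ pf).
  apply: ptime_pair; first exact/ptime_fst/ptime_id.
  exact/ptime_snd/ptime_snd/ptime_id.
- exact: ptime_const.
- by move=> s; lia.
- by move=> s; lia.
- move=> a s x; rewrite code_size_cons.
  have := he (a, x); rewrite code_size_pair /= => h1.
  have h2 : 0 < code_size a + code_size x by rewrite addn_gt0 code_size_gt0.
  by have := hd _ h2; lia.
Qed.

Lemma ptime_cat {A X} {EA : Enc A} {EX : Enc X} (f g : A -> seq X) :
  ptime f -> ptime g -> ptime (fun a => f a ++ g a).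
Proof.
move=> pf pg; apply: (eq_ptime (f := fun a => catrev (rev (f a)) (g a))).
  by move=> a; rewrite catrevE revK.
by apply: ptime_catrev => //; apply: ptime_rev.
Qed.

Lemma ptime_flatten {A X} {EA : Enc A} {EX : Enc X} (f : A -> seq (seq X)) :
  ptime f -> ptime (fun a => flatten (f a)).
Proof.
move=> pf; apply: (eq_ptime (f := fun a => foldl (fun o x => o ++ x) [::] (f a))).
  move=> a; rewrite -[RHS]cat0s; elim: (f a) [::] => [|x s IH] t /=.
    by rewrite cats0.
  by rewrite IH catA.
apply: (@ptime_foldl_measure _ _ _ _ _ _ (fun _ o x => o ++ x) _ _ code_size 1 1) => //.
- by apply: ptime_cat; [apply: ptime_fst|apply: ptime_snd]; apply/ptime_snd/ptime_id.
- exact: ptime_const.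
- by move=> s; lia.
- by move=> s; lia.
- move=> a s x; have := @code_size_cat _ EX s x; lia.
Qed.

(** The fold runs over one list and takes heads of the other, which requires a default element. An
    arbitrary type might have none, but trees have [Leaf]; [ptime_zip] transfers the result, as
    [zip] commutes with encoding. *)
Lemma ptime_zip_tree :
  ptime (fun p : seq tree * seq tree => zip p.1 p.2).
Proof.
pose step (st : seq tree * seq (tree * tree)) x :=
  if nilp st.1 then st else (behead st.1, (x, head Leaf st.1) :: st.2).
apply: (eq_ptime (f := fun p : seq tree * seq tree =>
  rev (foldl step (p.2, [::]) p.1).2)).
  case=> s t /=; rewrite -[RHS]cat0s -[[::] in RHS]/(rev [::]).
  elim: s t [::] => [|x s IH] [|y t] o /=; rewrite ?cats0 //.
    by elim: (s) => //=.
  by rewrite /step /= IH rev_cons cat_rcons.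
apply/ptime_rev/ptime_snd.
have p1 := ptime_fst ptime_id (A := seq tree * seq tree).
apply: (@ptime_foldl_measure _ _ _ _ _ _ (fun _ => step) _ _ code_size 1 1) => //.
- have p21 : ptime (fun p : (seq tree * seq tree) *
      ((seq tree * seq (tree * tree)) * tree) => p.2.1).
    exact/ptime_fst/ptime_snd/ptime_id.
  apply: ptime_if => //; first exact/ptime_nilp/ptime_fst.
  apply: ptime_pair; first exact/ptime_behead/ptime_fst.
  apply: ptime_cons; last exact: ptime_snd.
  apply: ptime_pair; last exact/ptime_head/ptime_fst.
  exact/ptime_snd/ptime_snd/ptime_id.
- by apply: ptime_pair; [exact/ptime_snd/ptime_id|exact: ptime_const].
- by move=> s; lia.
- by move=> s; lia.
- move=> a [[|y t] o] x; rewrite /step /=; first lia.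
  rewrite !(code_size_pair, code_size_cons); lia.
Qed.

Lemma ptime_zip {A X Y} {EA : Enc A} {EX : Enc X} {EY : Enc Y}
    (f : A -> seq X) (g : A -> seq Y) :
  ptime f -> ptime g -> ptime (fun a => zip (f a) (g a)).
Proof.
apply: ptime_comp2; pose h (p : seq X * seq Y) := (map EX p.1, map EY p.2).
apply: (ptime_recode (h := h)) ptime_zip_tree => -[s t].
  by rewrite /enc /= /enc_pair /= /enc /= /enc_seq -!map_comp.
rewrite /enc /= /enc_seq; congr list_tree; rewrite /h /=.
by elim: s t => [|x s IH] [|y t] //=; rewrite -IH.
Qed.

Lemma ptime_foldr_measure {A S X} {EA : Enc A} {ES : Enc S} {EX : Enc X}
    (f : A -> X -> S -> S) (s0 : A -> S) (l : A -> seq X) (mu : S -> nat) K d :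
  ptime (fun p : A * (X * S) => f p.1 p.2.1 p.2.2) -> ptime s0 -> ptime l ->
  (forall s, code_size s <= K * mu s + K) ->
  (forall s, mu s <= K * code_size s) ->
  (forall a s x, mu (f a x s) <= mu s + (code_size a + code_size x).+1 ^ d) ->
  ptime (fun a => foldr (f a) (s0 a) (l a)).
Proof.
move=> pf ps pl hK hmu hstep.
apply: (eq_ptime (f := fun a => foldl (fun s x => f a x s) (s0 a) (rev (l a)))).
  by move=> a; rewrite foldl_rev.
apply: (@ptime_foldl_measure _ _ _ _ _ _ (fun a s x => f a x s) _ _ mu K d) => //.
- apply: (ptime_comp (f := fun p : A * (S * X) => (p.1, (p.2.2, p.2.1))) _ pf).
  apply: ptime_pair; first exact/ptime_fst/ptime_id.
  by apply: ptime_pair; [apply: ptime_snd|apply: ptime_fst]; apply/ptime_snd/ptime_id.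
- exact: ptime_rev.
Qed.

(** Unrolled recursion: with the length of the list bounded by a constant, the
    intermediate results may grow polynomially at each step. *)
Lemma ptime_foldr_const {A S X} {EA : Enc A} {ES : Enc S} {EX : Enc X} k (x0 : X)
    (f : A -> X -> S -> S) (s0 : A -> S) (l : A -> seq X) :
  (forall a, size (l a) <= k) ->
  ptime (fun p : A * (X * S) => f p.1 p.2.1 p.2.2) -> ptime s0 -> ptime l ->
  ptime (fun a => foldr (f a) (s0 a) (l a)).
Proof.
move=> hk pf ps; elim: k l hk => [|k IH] l hk pl.
  by apply: eq_ptime ps => a; case: (l a) (hk a).
pose g a := if nilp (l a) then s0 a else
  f a (head x0 (l a)) (foldr (f a) (s0 a) (behead (l a))).
apply: (eq_ptime (f := g)) => [a|]; first by rewrite /g; case: (l a).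
apply: ptime_if => //; first exact: ptime_nilp.
have hb a : size (behead (l a)) <= k by rewrite size_behead; have := hk a; lia.
have pt := IH (fun a => behead (l a)) hb (ptime_behead pl).
apply: (ptime_comp (f := fun a => (a, (head x0 (l a),
  foldr (f a) (s0 a) (behead (l a))))) _ pf).
apply: ptime_pair; first exact: ptime_id.
by apply: ptime_pair; [exact: ptime_head | exact: pt].
Qed.

Lemma ptime_andb {A} {EA : Enc A} (f g : A -> bool) :
  ptime f -> ptime g -> ptime (fun a => f a && g a).
Proof. by move=> pf pg; apply: ptime_if => //; apply: ptime_const. Qed.

Lemma ptime_orb {A} {EA : Enc A} (f g : A -> bool) :
  ptime f -> ptime g -> ptime (fun a => f a || g a).
Proof. by move=> pf pg; apply: ptime_if => //; apply: ptime_const. Qed.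

Lemma ptime_negb {A} {EA : Enc A} (f : A -> bool) :
  ptime f -> ptime (fun a => ~~ f a).
Proof. by move=> pf; apply: ptime_if => //; apply: ptime_const. Qed.

Lemma ptime_addb {A} {EA : Enc A} (f g : A -> bool) :
  ptime f -> ptime g -> ptime (fun a => f a (+) g a).
Proof.
move=> pf pg; apply: (eq_ptime (f := fun a => if f a then ~~ g a else g a)).
  by move=> a; case: (f a).
by apply: ptime_if => //; apply: ptime_negb.
Qed.

(** * Binary arithmetic *)

(** A hook, redefined once rational arithmetic is available, through which [ptime] learns further
    functions. *)
Ltac ptime_user := fail.

Ltac ptime_step :=
  cbv beta; first [ assumption | lazymatch goal with
  | |- ptime (fun a => a) => exact: ptime_id
  | |- ptime (fun _ => ?c) => exact: ptime_const
  | |- ptime (fun a => fst _) => apply: ptime_fst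
  | |- ptime (fun a => snd _) => apply: ptime_snd
  | |- ptime (fun a => (_, _)) => apply: ptime_pair
  | |- ptime (fun a => if _ then _ else _) => apply: ptime_if
  | |- ptime (fun a => _ && _) => apply: ptime_andb
  | |- ptime (fun a => _ || _) => apply: ptime_orb
  | |- ptime (fun a => ~~ _) => apply: ptime_negb
  | |- ptime (fun a => _ (+) _) => apply: ptime_addb
  | |- ptime (fun a => _ :: _) => apply: ptime_cons
  | |- ptime (fun a => behead _) => apply: ptime_behead
  | |- ptime (fun a => head _ _) => apply: ptime_head
  | |- ptime (fun a => nilp _) => apply: ptime_nilp
  | |- ptime (fun a => rev _) => apply: ptime_rev
  | |- ptime (fun a => _ ++ _) => apply: ptime_cat
  | |- ptime (fun a => flatten _) => apply: ptime_flatten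
  | |- ptime (fun a => zip _ _) => apply: ptime_zip
  | |- ptime (fun a => map _ _) => apply: ptime_map
  | |- @ptime ?A ?B ?EA ?EB ?f => first
      [ ptime_user
      | let g := eval cbv beta in (fun a : A => f a) in
        progress change (@ptime A B EA EB g) ]
  end ].

Ltac ptime := repeat ptime_step.

Local Notation natc := (seq bool).
Local Notation intc := (bool * natc)%type.
Local Notation ratc := (intc * natc)%type.

Lemma code_size_bits (s : natc) : code_size s <= 4 * size s + 1.
Proof.
elim: s => // b s IH; rewrite code_size_cons /=.
have : code_size b <= 3 by case: b.
lia.
Qed.

Lemma binary_value_cat s t :
  binary_value (s ++ t) = binary_value s + 2 ^ size s * binary_value t.
Proof.
elim: s => [|b s IH] /=; first by rewrite mul1n.
by rewrite IH expnS -!muln2; lia.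
Qed.

Lemma binary_value_rcons s b :
  binary_value (rcons s b) = binary_value s + 2 ^ size s * b.
Proof. by rewrite -cats1 binary_value_cat /= addn0. Qed.

Lemma binary_value_lt s : binary_value s < 2 ^ size s.
Proof. by elim: s => //= b s IH; rewrite expnS -muln2; case: b; lia. Qed.

(** Leading zeros are legitimate, so operands are brought to a common length and the adder has to
    treat only that case. *)
Definition pad (t s : natc) : natc := s ++ [seq false | _ <- drop (size s) t].

Lemma size_pad t s : size (pad t s) = maxn (size s) (size t).
Proof. by rewrite size_cat size_map size_drop maxnE. Qed.

Lemma binary_value_pad t s : binary_value (pad t s) = binary_value s.
Proof.
rewrite /pad binary_value_cat; elim: (drop _ _) => [|b l IH] /=.
  by rewrite muln0 addn0.
by rewrite -[RHS]IH; nia.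
Qed.

Lemma ptime_pad : ptime (fun p : natc * natc => pad p.1 p.2).
Proof.
(* [drop (size s) t] is obtained without counting: one [behead] of [t] for each bit of [s]. *)
apply: (eq_ptime (f := fun p : natc * natc =>
  p.2 ++ [seq false | _ <- foldl (fun r _ => behead r) p.1 p.2])).
  move=> [t s]; rewrite /pad /=; congr (_ ++ map _ _).
  by elim: s t => [|b s IH] [|c t] //=; rewrite ?IH //; case: (s).
ptime.
apply: (ptime_foldl_measure (f := fun (_ : natc * natc) (r : natc) (_ : bool) => behead r)
  (s0 := fst) (l := snd) (mu := @code_size natc _) (K := 1) (d := 1));
  try by ptime.
- by move=> s; lia.
- by move=> s; lia.
- move=> a [|x s] y /=; first lia.
  rewrite code_size_cons; lia.
Qed.

(** Full adder; with [s] set it complements [x], which turns the carry into the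
    borrow of the subtraction of [y] from [x]. *)
Definition carry_out (s x y c : bool) : bool :=
  ((x (+) s) && y) || (c && ((x (+) s) || y)).

Definition ripple_step (s : bool) (st : bool * natc) (xy : bool * bool) :=
  (carry_out s xy.1 xy.2 st.1, (xy.1 (+) xy.2 (+) st.1) :: st.2).

Definition ripple (s : bool) (a b : natc) : bool * natc :=
  foldl (ripple_step s) (false, [::]) (zip (pad b a) (pad a b)).

Lemma ptime_ripple s : ptime (fun p : natc * natc => ripple s p.1 p.2).
Proof.
apply: (@ptime_foldl_measure _ _ _ _ _ _ (fun _ => ripple_step s)
  (fun p => (false, [::])) _ code_size 1 1).
- rewrite /ripple_step /carry_out; ptime.
- ptime.
- apply: ptime_zip; apply: (ptime_comp2 ptime_pad); ptime.
- by move=> t; lia.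
- by move=> t; lia.
- move=> [a b] [c o] [x y]; rewrite /ripple_step /= !code_size_pair code_size_cons.
  have h (u v : bool) : code_size u <= code_size v + 2 by case: u v => -[].
  have := h (carry_out s x y c) c; have := h (x (+) y (+) c) x.
  have : 0 < code_size a by []; have : 0 < code_size b by [].
  by have : 0 < code_size y by []; lia.
Qed.

(** Invariant of the pass: the digits in [o], stored in reverse, are final, and the unread digits
    together with the carry [c] weigh [2 ^ size o]. For subtraction [c] is a borrow and therefore
    stands on the side of [b]. *)
Lemma ripple_stepE s a b c o : size a = size b ->
  let r := foldl (ripple_step s) (c, o) (zip a b) in
  size r.2 = size o + size a /\
  if s then binary_value (rev r.2) + 2 ^ size o * (binary_value b + c) =
            binary_value (rev o) + 2 ^ size o * binary_value a + 2 ^ size r.2 * r.1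
  else binary_value (rev r.2) + 2 ^ size r.2 * r.1 =
       binary_value (rev o) + 2 ^ size o * (binary_value a + binary_value b + c).
Proof.
elim: a b c o => [|x a IH] [|y b] c o //=.
  by split; [rewrite addn0|case: (s); lia].
move=> [/IH{}IH].
have [-> e] := IH (carry_out s x y c) (x (+) y (+) c :: o); split; clear IH.
  by rewrite /= addSnnS.
move: e; rewrite /ripple_step /= rev_cons binary_value_rcons size_rev expnS -!muln2.
move: (foldl _ _ _) (2 ^ size o) (binary_value (rev o)) => r P V.
by case: s; case: x; case: y; case: c; rewrite /carry_out /=; lia.
Qed.

Lemma rippleE s a b :
  let r := ripple s a b in
  size r.2 = maxn (size a) (size b) /\
  if s then binary_value (rev r.2) + binary_value b =
            binary_value a + 2 ^ size r.2 * r.1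
  else binary_value (rev r.2) + 2 ^ size r.2 * r.1 =
       binary_value a + binary_value b.
Proof.
have e : size (pad b a) = size (pad a b) by rewrite !size_pad maxnC.
have [/= -> h] := ripple_stepE s false [::] e; split; first by rewrite size_pad.
by move: h; rewrite !binary_value_pad /= !mul1n !addn0 !add0n; case: (s).
Qed.

Definition nadd (a b : natc) : natc :=
  let r := ripple false a b in rev (r.1 :: r.2).

Lemma nadd_value a b :
  binary_value (nadd a b) = binary_value a + binary_value b.
Proof.
have [_ <-] := rippleE false a b.
by rewrite /nadd rev_cons binary_value_rcons size_rev.
Qed.

Lemma size_nadd a b : size (nadd a b) = (maxn (size a) (size b)).+1.
Proof. by have [e _] := rippleE false a b; rewrite size_rev /= e. Qed.

Lemma ptime_nadd : ptime (fun p : natc * natc => nadd p.1 p.2).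
Proof. rewrite /nadd; have := ptime_ripple false => h; ptime. Qed.

(** The borrow and, when there is none, the difference. *)
Definition nsub (a b : natc) : bool * natc :=
  let r := ripple true a b in (r.1, rev r.2).

(** The digits produced have a value below the weight of the last borrow, so that borrow is
    determined by the sign of the difference. Subtraction thereby doubles as comparison. *)
Lemma nsub_borrow a b : (nsub a b).1 = (binary_value a < binary_value b).
Proof.
have [_] := rippleE true a b; rewrite /nsub /=.
have := binary_value_lt (rev (ripple true a b).2); rewrite size_rev.
set V := binary_value _; set P := 2 ^ _; case: (ripple _ _ _).1 => h e.
  by apply/esym; lia.
by apply/esym/negbTE; lia.
Qed.

Lemma nsub_value a b : binary_value b <= binary_value a ->
  binary_value (nsub a b).2 = binary_value a - binary_value b.
Proof.
move=> le; have [_] := rippleE true a b; have := nsub_borrow a b.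
by rewrite ltnNge le /nsub /= => ->; rewrite muln0 addn0 => <-; rewrite addnK.
Qed.

Lemma size_nsub a b : size (nsub a b).2 = maxn (size a) (size b).
Proof. by have [e _] := rippleE true a b; rewrite /nsub /= size_rev. Qed.

Lemma ptime_nsub : ptime (fun p : natc * natc => nsub p.1 p.2).
Proof. rewrite /nsub; have := ptime_ripple true => h; ptime. Qed.

Definition nmul (a b : natc) : natc :=
  foldr (fun x acc => nadd (if x then b else [::]) (false :: acc)) [::] a.

Lemma nmul_value a b :
  binary_value (nmul a b) = binary_value a * binary_value b.
Proof.
elim: a => //= x a IH; rewrite nadd_value /= IH -!muln2.
by case: x => /=; nia.
Qed.

(** Each bit of [a] costs one place for the shift and one for the carry. What matters later is the
    coefficient 1 of [size b]. *)
Lemma size_nmul a b : size (nmul a b) <= size b + 2 * size a.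
Proof.
elim: a => //= x a IH; rewrite size_nadd /=.
by case: x => /=; lia.
Qed.

Lemma ptime_nmul : ptime (fun p : natc * natc => nmul p.1 p.2).
Proof.
apply: (@ptime_foldr_measure _ _ _ _ _ _
  (fun p x acc => nadd (if x then p.2 else [::]) (false :: acc))
  (fun=> [::]) _ size 4 1); try by ptime.
- apply: (ptime_comp2 ptime_nadd); ptime.
- by move=> s; have := code_size_bits s; lia.
- by move=> s; have := @size_code_size _ enc_bool s; lia.
- move=> [a b] s x; rewrite size_nadd /= code_size_pair expn1.
  have := @size_code_size _ enc_bool b; have : 0 < code_size x by [].
  by case: x => /=; lia.
Qed.

(** * Integers in sign-magnitude form and unreduced fractions *)

Definition iadd (x y : intc) : intc :=
  if x.1 (+) y.1 then
    if (nsub x.2 y.2).1 then (y.1, (nsub y.2 x.2).2) else (x.1, (nsub x.2 y.2).2)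
  else (x.1, nadd x.2 y.2).

Definition int_value (x : intc) : int := ((-1) ^+ x.1 * (binary_value x.2)%:Z)%R.

Lemma iadd_value x y : int_value (iadd x y) = (int_value x + int_value y)%R.
Proof.
case: x y => [s m] [t n]; rewrite /iadd /int_value.
have := @nsub_value n m; have := @nsub_value m n; have := nsub_borrow m n.
have := nadd_value m n.
move: (nadd m n) (nsub m n) (nsub n m) => a [c d] [c' d'] /= + ->.
case: ltnP => h ha hd hd'; case e: (s (+) t) => /=.
- by rewrite hd' 1?ltnW //; case: s t e => -[] //= _;
    rewrite ?expr0 ?expr1 ?mulN1r ?mul1r; lia.
- by rewrite ha; case: s t e => -[] //= _; rewrite ?expr0 ?expr1 ?mulN1r ?mul1r; lia.
- by rewrite hd //; case: s t e => -[] //= _; rewrite ?expr0 ?expr1 ?mulN1r ?mul1r; lia.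
- by rewrite ha; case: s t e => -[] //= _; rewrite ?expr0 ?expr1 ?mulN1r ?mul1r; lia.
Qed.

Lemma size_iadd x y : size (iadd x y).2 <= (maxn (size x.2) (size y.2)).+1.
Proof.
rewrite /iadd; case: ifP => _; last by rewrite size_nadd.
by case: ifP => _ /=; rewrite size_nsub; lia.
Qed.

Lemma ptime_iadd : ptime (fun p : intc * intc => iadd p.1 p.2).
Proof.
rewrite /iadd; ptime.
all: by apply: (ptime_comp2 ptime_nsub) || apply: (ptime_comp2 ptime_nadd); ptime.
Qed.

(** Zero may carry a negative sign, so the sign bit does not decide; the borrow of 0 minus the
    magnitude tells whether the magnitude is positive. *)
Definition inonneg (x : intc) : bool := ~~ (x.1 && (nsub [::] x.2).1).

Lemma inonnegE x : inonneg x = (0 <= int_value x)%R.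
Proof.
rewrite /inonneg nsub_borrow /int_value; case: x.1; last by rewrite expr0 mul1r; lia.
rewrite expr1 mulN1r /=; lia.
Qed.

Definition rat_value (r : ratc) : rat :=
  ((int_value r.1)%:~R / (binary_value r.2)%:R)%R.

Definition represents (r : ratc) (q : rat) : Prop :=
  0 < binary_value r.2 /\ q = rat_value r.

(** The bridge between the relational codes of the specification and the bit-level data on which the
    programs compute. *)
Lemma rat_codeE q t : rat_code q t <-> exists2 r : ratc, t = enc r & represents r q.
Proof.
split=> [[a [b [b0 -> [ta [tb [-> [s [m [-> [ts [tm [-> -> [w -> E1]]]]]]] [w' -> E2]]]]]]]|].
  exists ((s, w), w') => //; split; rewrite /rat_value /int_value /= ?E1 E2 //.
move=> [[[s w] w'] -> [b0 ->]]; exists (int_value (s, w)), (binary_value w'); split=> //.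
exists (enc (s, w)), (enc w'); split=> //; last by exists w'.
exists s, (binary_value w); split=> //; exists (enc s), (enc w); split=> //.
by exists w.
Qed.

Definition rzero : ratc := ((false, [::]), [:: true]).

Lemma represents_rzero : represents rzero 0.
Proof. by split. Qed.

Definition rnat (m : natc) : ratc := ((false, m), [:: true]).

Lemma represents_rnat m : represents (rnat m) (binary_value m)%:R.
Proof. by split=> //; rewrite /rat_value /int_value /= expr0 mul1r divr1. Qed.

Definition radd (x y : ratc) : ratc :=
  (iadd (x.1.1, nmul x.1.2 y.2) (y.1.1, nmul x.2 y.1.2), nmul x.2 y.2).

Definition ropp (x : ratc) : ratc := ((~~ x.1.1, x.1.2), x.2).

Definition rmul (x y : ratc) : ratc :=
  ((x.1.1 (+) y.1.1, nmul x.1.2 y.1.2), nmul x.2 y.2).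

Local Open Scope ring_scope.

Lemma represents_radd x y p q :
  represents x p -> represents y q -> represents (radd x y) (p + q).
Proof.
move=> [x0 ->] [y0 ->]; split; first by rewrite /= nmul_value muln_gt0 x0.
rewrite /rat_value /= iadd_value /int_value /= !nmul_value !PoszM !natrM.
rewrite rmorphD !rmorphM /=.
have nx : (binary_value x.2)%:R != 0 :> rat by rewrite pnatr_eq0 -lt0n.
have ny : (binary_value y.2)%:R != 0 :> rat by rewrite pnatr_eq0 -lt0n.
by field; rewrite nx ny.
Qed.

Lemma represents_ropp x p : represents x p -> represents (ropp x) (- p).
Proof.
move=> [x0 ->]; split=> //; rewrite /rat_value /ropp /int_value /=.
by case: x.1.1; rewrite /= ?expr0 ?expr1 ?mulN1r ?mul1r ?rmorphN ?mulNr ?opprK.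
Qed.

Lemma represents_rmul x y p q :
  represents x p -> represents y q -> represents (rmul x y) (p * q).
Proof.
move=> [x0 ->] [y0 ->]; split; first by rewrite /= nmul_value muln_gt0 x0.
rewrite /rat_value /= /int_value /= !nmul_value !PoszM !natrM signr_addb.
rewrite !rmorphM /= invfM; ring.
Qed.

Lemma represents_inonneg x p : represents x p -> inonneg x.1 = (0 <= p).
Proof.
move=> [x0 ->]; have d0 : 0 < (binary_value x.2)%:R^-1 :> rat by rewrite invr_gt0 ltr0n.
by rewrite inonnegE /rat_value [RHS]pmulr_lge0 // ler0z.
Qed.
Local Close Scope ring_scope.

Definition rsub (x y : ratc) : ratc := radd x (ropp y).

Lemma represents_rsub x y p q :
  represents x p -> represents y q -> represents (rsub x y) (p - q)%R.
Proof. by move=> hx hy; apply/represents_radd/represents_ropp. Qed.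

Definition rmax0 (x : ratc) : ratc := if inonneg x.1 then x else rzero.

Definition rle (x y : ratc) : bool := inonneg (rsub y x).1.

Lemma represents_rmax0 x p :
  represents x p -> represents (rmax0 x) (Num.max 0 p)%R.
Proof.
move=> hx; rewrite /rmax0 (represents_inonneg hx) maxEle.
by case: ifP => _ //; apply: represents_rzero.
Qed.

Lemma rleE x y p q :
  represents x p -> represents y q -> rle x y = (p <= q)%R.
Proof.
move=> hx hy.
rewrite /rle (represents_inonneg (represents_rsub hy hx)).
by rewrite subr_ge0.
Qed.

Definition rat_length (x : ratc) : nat := maxn (size x.1.2) (size x.2).

(** The asymmetry comes from [size_nmul]: in [radd] the digits of [x] are always the first factor. A
    fold that keeps its accumulator as the second summand therefore grows only by the length of the
    new term, as [ptime_foldr_measure] demands. *)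
Lemma rat_length_radd x y :
  rat_length (radd x y) <= rat_length y + 2 * rat_length x + 1.
Proof.
rewrite /rat_length /radd /=.
have := size_iadd (x.1.1, nmul x.1.2 y.2) (y.1.1, nmul x.2 y.1.2).
move=> /=; have := size_nmul x.1.2 y.2; have := size_nmul x.2 y.1.2.
have := size_nmul x.2 y.2; lia.
Qed.

Lemma code_size_rat x : code_size x <= 8 * rat_length x + 8.
Proof.
case: x => [[s m] n]; rewrite !code_size_pair /rat_length /=.
have := code_size_bits m; have := code_size_bits n.
have h : code_size s <= 3 by case: (s).
lia.
Qed.

Lemma rat_length_code_size x : rat_length x <= code_size x.
Proof.
case: x => [[s m] n]; rewrite !code_size_pair /rat_length /=.
have := @size_code_size _ enc_bool m; have := @size_code_size _ enc_bool n; lia.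
Qed.

Lemma ptime_inonneg : ptime (fun x : intc => inonneg x).
Proof. rewrite /inonneg; ptime; apply: (ptime_comp2 ptime_nsub); ptime. Qed.

Lemma ptime_rnat : ptime (fun m : natc => rnat m).
Proof. rewrite /rnat; ptime. Qed.

Lemma ptime_radd : ptime (fun p : ratc * ratc => radd p.1 p.2).
Proof.
rewrite /radd; ptime; last by apply: (ptime_comp2 ptime_nmul); ptime.
by apply: (ptime_comp2 ptime_iadd); ptime; apply: (ptime_comp2 ptime_nmul); ptime.
Qed.

Lemma ptime_rmul : ptime (fun p : ratc * ratc => rmul p.1 p.2).
Proof. by rewrite /rmul; ptime; apply: (ptime_comp2 ptime_nmul); ptime. Qed.

Lemma ptime_rsub : ptime (fun p : ratc * ratc => rsub p.1 p.2).
Proof. by rewrite /rsub /ropp; apply: (ptime_comp2 ptime_radd); ptime. Qed.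

Lemma ptime_rmax0 : ptime (fun x : ratc => rmax0 x).
Proof. by rewrite /rmax0; ptime; apply: (ptime_comp _ ptime_inonneg); ptime. Qed.

Lemma ptime_rle : ptime (fun p : ratc * ratc => rle p.1 p.2).
Proof.
rewrite /rle; apply: (ptime_comp _ ptime_inonneg); apply: ptime_fst.
by apply: (ptime_comp2 ptime_rsub); ptime.
Qed.

Ltac ptime_user ::=
  lazymatch goal with
  | |- ptime (fun a => rnat _) => apply: (ptime_comp _ ptime_rnat)
  | |- ptime (fun a => rsub _ _) => apply: (ptime_comp2 ptime_rsub)
  | |- ptime (fun a => radd _ _) => apply: (ptime_comp2 ptime_radd)
  | |- ptime (fun a => rmul _ _) => apply: (ptime_comp2 ptime_rmul)
  | |- ptime (fun a => rmax0 _) => apply: (ptime_comp _ ptime_rmax0)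
  | |- ptime (fun a => rle _ _) => apply: (ptime_comp2 ptime_rle)
  end.

(** * Reduction to nominal problems *)

Local Open Scope ring_scope.

(** The minimum over [b] of a convex piecewise linear function is attained at
    one of its breakpoints: from [p], move against the slope [G - k], where [k]
    counts the [e i] above [p], until the next breakpoint. *)
Lemma breakpoint_le (R : realFieldType) n (e rho : 'I_n -> R) (p : R) (G : nat) :
  (forall i, 0 <= rho i) -> (forall i, e i <= p + rho i) -> 0 <= p ->
  exists o : option 'I_n, let b := if o is Some i then e i else 0 in
    G%:R * b + \sum_i Num.max 0 (e i - b) <= G%:R * p + \sum_i rho i.
Proof.
move=> rho0 erho p0; pose val (o : option 'I_n) := if o is Some i then e i else 0.
pose k := #|[pred i | p < e i]|.
(* Summing the second condition over [i] adds [k] times [p - val o]; together with the change of the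
   [G] term this is the slope times the displacement, which the first condition makes
   nonpositive. *)
suff [o [hslope hb]] : exists o : option 'I_n,
    (G%:R - k%:R) * (val o - p) <= 0 /\
    forall i, Num.max 0 (e i - val o) <=
      rho i + (if p < e i then p - val o else 0).
  exists o; rewrite /= -/(val o).
  have : \sum_i Num.max 0 (e i - val o) <=
         \sum_i (rho i + (if p < e i then p - val o else 0)).
    by apply: ler_sum => i _.
  rewrite big_split /=.
  have -> : \sum_i (if p < e i then p - val o else 0) = (p - val o) *+ k.
    by rewrite -big_mkcond -sumr_const; apply: eq_bigl.
  rewrite -mulr_natl.
  by move: hslope; nra.
case: (leqP k G) => kG.
(* Nonnegative slope: go down to the largest breakpoint not above [p]. [None], standing for 0,
   always qualifies. *)
- have P0 : (fun o => val o <= p) None by [].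
  have [o op omax] :=
    @Order.TotalTheory.arg_maxP _ R _ None (fun o => val o <= p) val P0.
  exists o; split.
    rewrite mulr_ge0_le0 ?subr_ge0 ?ler_nat //; by rewrite subr_le0.
  move=> i; have := erho i; have := rho0 i.
  case: ltP => pe; rewrite ge_max; first by move: op; lra.
  by have := omax (Some i) pe; rewrite /=; lra.
(* Negative slope: then [k > 0], so some [e i] exceeds [p], and the smallest such one is the
   target. *)
- have [i0 pi0] : exists i : 'I_n, p < e i.
    have /card_gt0P[i hi] : (0 < k)%N.
      exact: leq_ltn_trans kG.
    by exists i.
  case: (@Order.TotalTheory.arg_minP _ R _ i0 (fun i => p < e i) e pi0) => j pj jmin.
  exists (Some j); rewrite /=; split.
    by rewrite mulr_le0_ge0 ?subr_le0 ?ler_nat ?(ltnW kG) // subr_ge0 ltW.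
  move=> i; have := erho i; have := rho0 i.
  case: ltP => pe; rewrite ge_max; last lra.
  by have := jmin i pe; lra.
Qed.

Section Reduction.

Variables (R : realFieldType) (C : nominal_class) (N : nat).
Variable I : bwrp_instance C N.
Local Notation n := (Defs.dim (rob_set I)).

Definition deviation (j : 'I_N) (i : 'I_n) : rat := cost_hi I j i - cost_lo I j i.

Lemma deviation_ge0 j i : 0 <= deviation j i.
Proof. by rewrite subr_ge0 cost_lo_le_hi. Qed.

Definition excess (p : 'I_N -> rat) (j : 'I_N) (i : 'I_n) : rat :=
  Num.max 0 (deviation j i - p j).

Definition reduced_cost (p : 'I_N -> rat) (i : 'I_n) : rat :=
  \sum_j weight I j * (cost_lo I j i + excess p j i).

Definition reduced_value (p : 'I_N -> rat) (x : {ffun 'I_n -> bool}) : rat :=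
  \sum_i reduced_cost p i * (x i)%:R +
  \sum_j weight I j * ((budget I j)%:R * p j).

(** Weights and excesses are nonnegative, so nonnegative lower costs give nonnegative reduced costs:
    the subproblems stay in the class for either kind of admissible costs. *)
Lemma reduced_cost_admissible p : admissible C (reduced_cost p).
Proof.
move=> nn i; apply: sumr_ge0 => j _; apply: mulr_ge0; first exact: weight_ge0.
by rewrite addr_ge0 ?(cost_lo_admissible _ nn) // le_max lexx.
Qed.

Definition reduced_instance p : nominal_instance C :=
  NominalInstance (@reduced_cost_admissible p).

Lemma reduced_valueE p x : reduced_value p x =
  \sum_j weight I j * (\sum_i cost_lo I j i * (x i)%:R
    + (budget I j)%:R * p j + \sum_i excess p j i * (x i)%:R).
Proof.
rewrite /reduced_value /reduced_cost.
under eq_bigr do rewrite mulr_suml.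
rewrite exchange_big -big_split /=; apply: eq_bigr => j _.
under eq_bigr do rewrite -mulrA mulrDl.
by rewrite -mulr_sumr big_split /=; ring.
Qed.

(** Upper bound half of the reduction: with [reduced_bwrp_value], each reduced value at a feasible
    [x] and some [p >= 0] is the value of a feasible solution. *)
Lemma reduced_feasible p x : (forall j, 0 <= p j) ->
  x \in feasible_set (rob_set I) ->
  bwrp_feasible I x (fun j => ratr (p j) : R)
    (fun j i => ratr (excess p j i * (x i)%:R)).
Proof.
move=> p0 xX; split=> //.
- move=> i j; have -> : (x i)%:R = ratr (x i)%:R :> R by rewrite ratr_nat.
  rewrite -rmorphM -rmorphD ler_rat /=.
  rewrite -/(deviation j i) /excess.
  by have := p0 j; case: (leP 0 (deviation j i - p j)); case: (x i) => /= ? ?; lra.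
- by move=> j; rewrite ler0q.
- by move=> i j; rewrite ler0q mulr_ge0 // le_max lexx.
Qed.

Lemma reduced_bwrp_value p x :
  bwrp_value I x (fun j => ratr (p j) : R)
    (fun j i => ratr (excess p j i * (x i)%:R)) = ratr (reduced_value p x).
Proof.
rewrite reduced_valueE rmorph_sum; apply: eq_bigr => j _.
rewrite rmorphM !rmorphD rmorphM /= ratr_nat !rmorph_sum /=.
by congr (_ * (_ + _ + _)); apply: eq_bigr => i _; rewrite rmorphM /= ratr_nat.
Qed.

Definition breakpoints (p : 'I_N -> rat) : Prop :=
  forall j, p j = 0 \/ exists i, p j = deviation j i.

(** Lower bound half: for fixed [y] the objective separates over [j], and weights are nonnegative,
    so [breakpoint_le] can be applied to each [j] on its own. *)
Lemma reduced_value_le (y : {ffun 'I_n -> bool}) (p : 'I_N -> R) rho :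
  bwrp_feasible I y p rho ->
  exists2 b, breakpoints b & ratr (reduced_value b y) <= bwrp_value I y p rho.
Proof.
move=> [h1 p0 rho0 yX].
pose e j i : R := ratr (deviation j i * (y i)%:R).
have /fin_all_exists[o ho] j : exists o : option 'I_n,
    let b : R := if o is Some i then e j i else 0 in
    (budget I j)%:R * b + \sum_i Num.max 0 (e j i - b) <=
    (budget I j)%:R * p j + \sum_i rho j i.
  apply: breakpoint_le (p0 j) => i; first exact: rho0.
  by rewrite /e rmorphM /= ratr_nat; apply: h1.
pose b j : rat := if o j is Some i then deviation j i * (y i)%:R else 0.
have bE j : ratr (b j) = if o j is Some i then e j i else 0 :> R.
  by rewrite /b; case: (o j) => //; rewrite rmorph0.
have b0 j : 0 <= b j.
  by rewrite /b; case: (o j) => // i; rewrite mulr_ge0 // deviation_ge0.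
exists b => [j|].
  (* A breakpoint for [y] is a deviation if [y i] holds and 0 otherwise, so it is always among the
     candidates. *)
  rewrite /b; case: (o j) => [i|]; last by left.
  by case: (y i); [right; exists i; rewrite mulr1|left; rewrite mulr0].
rewrite reduced_valueE rmorph_sum; apply: ler_sum => j _.
rewrite rmorphM ler_wpM2l ?ler0q ?weight_ge0 //.
rewrite !rmorphD /= -!addrA; apply: lerD.
  by rewrite rmorph_sum; apply: ler_sum => i _; rewrite rmorphM /= ratr_nat.
apply: le_trans (ho j); rewrite -bE rmorphM /= ratr_nat lerD2l rmorph_sum.
apply: ler_sum => i _; rewrite /e -rmorphB.
have -> : Num.max 0 (ratr (deviation j i * (y i)%:R - b j)) =
          ratr (Num.max 0 (deviation j i * (y i)%:R - b j)) :> R.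
  rewrite !maxEle ler0q; case: ifP => _ //.
  by apply/esym/(rmorph0 (@ratr R)).
rewrite /= ler_rat /excess; have := b0 j.
by case: (leP 0 (deviation j i - b j)); case: (leP 0 (deviation j i * (y i)%:R - b j));
  case: (y i) => /= ? ? ?; lra.
Qed.

End Reduction.
Arguments deviation {C N} I j i.
Arguments excess {C N} I p j i.
Arguments reduced_cost {C N} I p i.
Arguments reduced_value {C N} I p x.
Arguments breakpoints {C N} I p.
Arguments reduced_instance {C N} I p.
Local Close Scope ring_scope.

(** * The algorithm *)

Local Notation data := (ratc * (natc * (seq ratc * seq ratc)))%type.
Local Notation budget_data d := (snd d).1.
Local Notation lo_data d := (snd (snd d)).1.
Local Notation hi_data d := (snd (snd d)).2.

Definition deviations (d : data) : seq ratc :=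
  [seq rsub q.2 q.1 | q <- zip (lo_data d) (hi_data d)].

Definition candidates (d : data) : seq ratc := rzero :: deviations d.

Definition tuples (ds : seq data) : seq (seq ratc) :=
  foldr (fun d acc => flatten [seq [seq c :: p | p <- acc] | c <- candidates d])
        [:: [::]] ds.

Definition cost_term (d : data) (p : ratc) : seq ratc :=
  [seq rmul d.1 (radd q.1 (rmax0 (rsub q.2 p))) | q <- zip (lo_data d) (deviations d)].

Definition no_data : data := (rzero, ([::], ([::], [::]))).

(** The encoding of the feasible set is opaque, so the dimension is read off the first uncertainty
    set, which exists because [N >= 1]. *)
Definition cost_vector (ds : seq data) (p : seq ratc) : seq ratc :=
  foldr (fun dp acc => [seq radd q.1 q.2 | q <- zip (cost_term dp.1 dp.2) acc])
        [seq rzero | _ <- lo_data (head no_data ds)] (zip ds p).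

Definition budget_cost (ds : seq data) (p : seq ratc) : ratc :=
  foldr (fun dp acc => radd (rmul dp.1.1 (rmul (rnat (budget_data dp.1)) dp.2)) acc)
        rzero (zip ds p).

Definition robust_value (ds : seq data) (p : seq ratc) (x : natc) : ratc :=
  foldr (fun q acc => if q.2 then radd q.1 acc else acc)
        (budget_cost ds p) (zip (cost_vector ds p) x).

Definition excesses (ds : seq data) (p : seq ratc) (x : natc) : seq (seq ratc) :=
  [seq [seq if q.2 then rmax0 (rsub q.1 dp.2) else rzero | q <- zip (deviations dp.1) x]
  | dp <- zip ds p].

Local Notation outcome := (ratc * (seq ratc * natc))%type.

(** Starting from the head of the list makes the result a member of every nonempty list; the default
    triple is reached only on the empty one. *)
Definition best (l : seq outcome) : outcome :=
  foldr (fun c b => if rle c.1 b.1 then c else b)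
        (head (rzero, ([::], [::])) l) l.

Definition outcomes (ds : seq data) (xs : seq natc) : seq outcome :=
  [seq (robust_value ds q.1 q.2, q) | q <- zip (tuples ds) xs].

Definition robust_output (ds : seq data) (xs : seq natc) :
    natc * (seq ratc * seq (seq ratc)) :=
  let b := (best (outcomes ds xs)).2 in (b.2, (b.1, excesses ds b.1 b.2)).

Section AlgorithmTime.

Variable N : nat.
Local Notation datas := (N.-tuple data).

Lemma ptime_tval {A X} {EA : Enc A} {EX : Enc X} n (f : A -> n.-tuple X) :
  ptime f -> ptime (fun a => tval (f a)).
Proof. exact: ptime_recode. Qed.

Lemma ptime_deviations : ptime (fun d : data => deviations d).
Proof. by rewrite /deviations; ptime. Qed.

Lemma ptime_cost_term : ptime (fun q : data * ratc => cost_term q.1 q.2).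
Proof.
by rewrite /cost_term; ptime; apply: (ptime_comp _ ptime_deviations); ptime.
Qed.

Lemma size_zip_tuple {T : Type} (ds : datas) (p : seq T) : size (zip ds p) <= N.
Proof. by rewrite size_zip size_tuple geq_minl. Qed.

(** Each uncertainty set multiplies the number of tuples by the number of candidates, which no
    additive measure permits. Here it is essential that [N] is constant. *)
Lemma ptime_tuples : ptime (fun ds : datas => tuples ds).
Proof.
apply: (@ptime_foldr_const _ _ _ _ _ _ N no_data
  (fun _ d acc => flatten [seq [seq c :: p | p <- acc] | c <- candidates d])
  (fun=> [:: [::]])) => [ds|||].
- by rewrite size_tuple.
- rewrite /candidates; ptime; apply: (ptime_comp _ ptime_deviations); ptime.
- ptime.
- by apply: ptime_tval; ptime.
Qed.

Lemma ptime_cost_vector :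
  ptime (fun q : datas * seq ratc => cost_vector q.1 q.2).
Proof.
apply: (@ptime_foldr_const _ _ _ _ _ _ N (no_data, rzero)
  (fun _ dp acc => [seq radd q.1 q.2 | q <- zip (cost_term dp.1 dp.2) acc])
  (fun q : datas * seq ratc => [seq rzero | _ <- lo_data (head no_data q.1)])
  (fun q : datas * seq ratc => zip q.1 q.2)) => [q|||].
- exact: size_zip_tuple.
- by ptime; apply: (ptime_comp2 ptime_cost_term); ptime.
- by ptime; apply: ptime_tval; ptime.
- by ptime; apply: ptime_tval; ptime.
Qed.

Lemma ptime_budget_cost :
  ptime (fun q : datas * seq ratc => budget_cost q.1 q.2).
Proof.
apply: (@ptime_foldr_const _ _ _ _ _ _ N (no_data, rzero)
  (fun _ dp acc => radd (rmul dp.1.1 (rmul (rnat (budget_data dp.1)) dp.2)) acc)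
  (fun=> rzero) (fun q : datas * seq ratc => zip q.1 q.2)) => [q|||].
- exact: size_zip_tuple.
- by ptime.
- by ptime.
- by ptime; apply: ptime_tval; ptime.
Qed.

(** Unlike the folds over the [N] uncertainty sets, this one has the length of the cost vector and
    cannot be unrolled. Its accumulator is controlled by [rat_length_radd]. *)
Lemma ptime_robust_value :
  ptime (fun q : datas * (seq ratc * natc) => robust_value q.1 q.2.1 q.2.2).
Proof.
apply: (ptime_foldr_measure (mu := rat_length) (K := 8) (d := 2)
  (f := fun _ (q : ratc * bool) acc => if q.2 then radd q.1 acc else acc)
  (s0 := fun q : datas * (seq ratc * natc) => budget_cost q.1 q.2.1)
  (l := fun q => zip (cost_vector q.1 q.2.1) q.2.2)).
- by ptime.
- by apply: (ptime_comp (f := fun q => (q.1, q.2.1)) _ ptime_budget_cost); ptime.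
- apply: ptime_zip; last by ptime.
  by apply: (ptime_comp (f := fun q => (q.1, q.2.1)) _ ptime_cost_vector); ptime.
- exact: code_size_rat.
- by move=> s; have := rat_length_code_size s; lia.
- move=> a s [c b] /=; have := rat_length_radd c s; have := rat_length_code_size c.
  rewrite code_size_pair; have : 0 < code_size a by []; have : 0 < code_size b by [].
  by case: b => /= h1 h2 h3 h4; rewrite -mulnn; nia.
Qed.

Lemma ptime_excesses :
  ptime (fun q : datas * (seq ratc * natc) => excesses q.1 q.2.1 q.2.2).
Proof.
rewrite /excesses; ptime; last by apply: ptime_tval; ptime.
by apply: (ptime_comp _ ptime_deviations); ptime.
Qed.

Lemma ptime_best : ptime (fun l : seq outcome => best l).
Proof.
apply: (@ptime_foldr_measure _ _ _ _ _ _ (fun _ c b => if rle c.1 b.1 then c else b)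
  (head (rzero, ([::], [::]))) id (@code_size outcome _) 1 1).
- by ptime.
- by ptime.
- exact: ptime_id.
- by move=> s; lia.
- by move=> s; lia.
- by move=> a s x; case: ifP => _; lia.
Qed.

Lemma ptime_robust_output :
  ptime (fun q : datas * seq natc => robust_output q.1 q.2).
Proof.
have pb : ptime (fun q : datas * seq natc => (best (outcomes q.1 q.2)).2).
  apply: ptime_snd; apply: (ptime_comp _ ptime_best); rewrite /outcomes; ptime.
    by apply: (ptime_comp (f := fun q => (q.1.1, q.2)) _ ptime_robust_value); ptime.
  by apply: (ptime_comp _ ptime_tuples); ptime.
rewrite /robust_output; ptime.
apply: (ptime_comp (f := fun q : datas * seq natc =>
  (q.1, (best (outcomes q.1 q.2)).2)) _ ptime_excesses).
by ptime.
Qed.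

End AlgorithmTime.

(** * Correctness of the algorithm *)

Lemma vec_codeE (T : Type) n (P : 'I_n -> T -> Prop) (Q : 'I_n -> tree -> Prop)
    {ET : Enc T} t :
  (forall i u, Q i u -> exists2 r, u = enc r & P i r) ->
  vec_code Q t ->
  exists2 r : 'I_n -> T, t = enc [seq r i | i <- enum 'I_n] & forall i, P i (r i).
Proof.
move=> QP [g -> hg].
have /fin_all_exists2[r hr Pr] i := QP i _ (hg i).
by exists r; rewrite // /enc /enc_seq -map_comp; congr list_tree; apply: eq_map.
Qed.

Lemma vec_code_enc (T : Type) n (Q : 'I_n -> tree -> Prop) {ET : Enc T}
    (r : 'I_n -> T) :
  (forall i, Q i (enc (r i))) -> vec_code Q (enc [seq r i | i <- enum 'I_n]).
Proof.
by move=> h; exists (fun i => enc (r i)); rewrite // /enc /enc_seq -map_comp.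
Qed.

Local Open Scope ring_scope.

Lemma represents_value r : (0 < binary_value r.2)%N -> represents r (rat_value r).
Proof. by []. Qed.

Lemma represents_foldr (T : Type) (F : T -> ratc) (b : T -> bool) (f : T -> rat) z v s :
  (forall t, represents (F t) (f t)) -> represents z v ->
  represents (foldr (fun t acc => if b t then radd (F t) acc else acc) z s)
             (\sum_(t <- s) f t * (b t)%:R + v).
Proof.
move=> hF hz; elim: s => [|t s IH] /=; first by rewrite big_nil add0r.
rewrite big_cons -addrA; case: (b t); last by rewrite mulr0 add0r.
by rewrite mulr1; apply: represents_radd.
Qed.

Lemma mem_tuples ds p : (p \in tuples ds) =
  (size p == size ds) && all (fun dp => dp.2 \in candidates dp.1) (zip ds p).
Proof.
elim: ds p => [|d ds IH] p; first by rewrite mem_seq1 -size_eq0; case: p.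
apply/flatten_mapP/idP => [[c cd /mapP[q]]|].
  by rewrite -/(tuples ds) IH => /andP[/eqP sq aq] -> /=; rewrite sq eqxx cd.
case: p => [|c p] //= /andP[sp /andP[cd ap]]; exists c => //.
by apply: map_f; rewrite -/(tuples ds) IH ap andbT.
Qed.

Lemma best_min (l : seq outcome) : (0 < size l)%N ->
  all (fun c => 0 < binary_value c.1.2)%N l ->
  best l \in l /\ forall c, c \in l -> rat_value (best l).1 <= rat_value c.1.
Proof.
case: l => // h l _; rewrite /best [head _ _]/=; set l' := h :: l => hl.
have hh : h \in l' by rewrite mem_head.
(* The induction shortens the list while the initial value stays [h], hence the generalisation to
   lists of elements of [l']. *)
suff gen s : {subset s <= l'} ->
    foldr (fun c b => if rle c.1 b.1 then c else b) h s \in l' /\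
    forall c, c \in s -> rat_value (foldr (fun c b : outcome =>
      if rle c.1 b.1 then c else b) h s).1 <= rat_value c.1.
  exact: gen.
elim: s => [|c s IH] sub; first by split.
have cl : c \in l' by rewrite sub ?mem_head.
have /IH[bl bmin] : {subset s <= l'} by move=> e es; rewrite sub ?in_cons ?es ?orbT.
rewrite /=; set b := foldr _ _ _ in bl bmin *.
rewrite (rleE (represents_value (allP hl _ cl)) (represents_value (allP hl _ bl))).
case: leP => cb; split=> // e; rewrite in_cons => /orP[/eqP->|/bmin] //.
  exact: le_trans.
by move: cb; exact: ltW.
Qed.

Section AlgorithmCorrect.

Variables (C : nominal_class) (N : nat) (N_gt0 : (0 < N)%N) (I : bwrp_instance C N).
Local Notation n := (Defs.dim (rob_set I)).
Variables (w : 'I_N -> ratc) (g : 'I_N -> natc) (lo hi : 'I_N -> 'I_n -> ratc).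
Hypotheses (hw : forall j, represents (w j) (weight I j))
  (hg : forall j, binary_value (g j) = budget I j)
  (hlo : forall j i, represents (lo j i) (cost_lo I j i))
  (hhi : forall j i, represents (hi j i) (cost_hi I j i)).

Definition data_of j : data :=
  (w j, (g j, ([seq lo j i | i <- enum 'I_n], [seq hi j i | i <- enum 'I_n]))).

Local Notation ds := [seq data_of j | j <- enum 'I_N].

Lemma deviations_data_of j :
  deviations (data_of j) = [seq rsub (hi j i) (lo j i) | i <- enum 'I_n].
Proof. by rewrite /deviations /data_of /= zip_map -map_comp. Qed.

Lemma represents_deviation j i :
  represents (rsub (hi j i) (lo j i)) (deviation I j i).
Proof. exact: represents_rsub. Qed.

Definition point (p : seq ratc) (j : 'I_N) : rat := rat_value (nth rzero p j).

Lemma tuple_nth p : p \in tuples ds ->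
  p = [seq nth rzero p j | j : 'I_N <- enum 'I_N].
Proof.
rewrite mem_tuples size_map size_enum_ord => /andP[/eqP sp _].
apply: (@eq_from_nth _ rzero); first by rewrite size_map size_enum_ord.
move=> k; rewrite sp => kN; rewrite (nth_map (Ordinal kN)) ?size_enum_ord //.
by rewrite nth_enum_ord.
Qed.

Lemma nth_tuples p (j : 'I_N) : p \in tuples ds ->
  nth rzero p j = rzero \/
  exists i, nth rzero p j = rsub (hi j i) (lo j i).
Proof.
move=> hp; move: (hp); rewrite {1}(tuple_nth hp) mem_tuples => /andP[_].
rewrite zip_map all_map => /allP/(_ j); rewrite mem_enum => /(_ isT) /=.
rewrite in_cons => /orP[/eqP->|]; first by left.
by rewrite deviations_data_of => /mapP[i _ ->]; right; exists i.
Qed.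

Lemma represents_point p (j : 'I_N) : p \in tuples ds ->
  represents (nth rzero p j) (point p j).
Proof.
move=> hp; apply: represents_value.
have [->|[i ->]] := nth_tuples j hp; first by [].
by have [] := represents_deviation j i.
Qed.

Lemma point_breakpoints p : p \in tuples ds -> breakpoints I (point p).
Proof.
move=> hp j; rewrite /point; have [->|[i ->]] := nth_tuples j hp.
  by left; have [_ <-] := represents_rzero.
by right; exists i; have [_ ->] := represents_deviation j i.
Qed.

Lemma breakpoints_point b : breakpoints I b ->
  exists2 p, p \in tuples ds & point p =1 b.
Proof.
move=> hb.
have /fin_all_exists[f hf] j :
    exists r, r \in candidates (data_of j) /\ represents r (b j).
  have [->|[i ->]] := hb j.
    by exists rzero; split; [rewrite mem_head|apply: represents_rzero].
  exists (rsub (hi j i) (lo j i)); split; last exact: represents_deviation.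
  rewrite in_cons deviations_data_of; apply/orP; right.
  by apply/mapP; exists i; rewrite ?mem_enum.
exists [seq f j | j <- enum 'I_N].
  rewrite mem_tuples !size_map eqxx zip_map all_map; apply/allP => j _ /=.
  by have [] := hf j.
move=> j; rewrite /point (nth_map j) ?size_enum_ord // nth_ord_enum.
by have [_ [_ ->]] := hf j.
Qed.

Definition cost_entry (p : seq ratc) (i : 'I_n) : ratc :=
  foldr (fun (j : 'I_N) acc => radd (rmul (w j) (radd (lo j i)
           (rmax0 (rsub (rsub (hi j i) (lo j i)) (nth rzero p j))))) acc)
        rzero (enum 'I_N).

Lemma cost_vectorE p : p \in tuples ds ->
  cost_vector ds p = [seq cost_entry p i | i <- enum 'I_n].
Proof.
move=> /tuple_nth hp; rewrite /cost_vector [in LHS]hp zip_map foldr_map.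
have -> : [seq rzero | _ <- lo_data (head no_data ds)] = [seq rzero | _ <- enum 'I_n].
  case E : (enum 'I_N) => [|j s] /=; last by rewrite -map_comp.
  by exfalso; move: N_gt0; rewrite -[X in (_ < X)%N](size_enum_ord N) E.
rewrite /cost_entry; elim: (enum 'I_N) => //= j s ->.
rewrite /cost_term deviations_data_of /= zip_map -map_comp zip_map -map_comp.
exact: eq_map.
Qed.

Lemma represents_cost_entry p i : p \in tuples ds ->
  represents (cost_entry p i) (reduced_cost I (point p) i).
Proof.
move=> hp; pose F (j : 'I_N) := rmul (w j) (radd (lo j i)
           (rmax0 (rsub (rsub (hi j i) (lo j i)) (nth rzero p j)))).
have hF j : represents (F j) (weight I j * (cost_lo I j i + excess I (point p) j i)).
  apply/represents_rmul/represents_radd => //.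
  apply: represents_rmax0; apply: represents_rsub; first exact: represents_deviation.
  exact: represents_point.
have := represents_foldr (fun=> true) (enum 'I_N) hF represents_rzero.
rewrite addr0 big_enum /=; under eq_bigr do rewrite mulr1; exact.
Qed.

Lemma represents_robust_value p (x : {ffun 'I_n -> bool}) : p \in tuples ds ->
  represents (robust_value ds p [seq x i | i <- enum 'I_n])
             (reduced_value I (point p) x).
Proof.
move=> hp; rewrite /robust_value cost_vectorE // zip_map foldr_map.
rewrite /reduced_value -[\sum_i _]big_enum.
apply: (represents_foldr (F := cost_entry p) x) => [i|].
  exact: represents_cost_entry.
rewrite /budget_cost [in X in zip _ X](tuple_nth hp) zip_map foldr_map.
have hF j : represents (rmul (w j) (rmul (rnat (g j)) (nth rzero p j)))
    (weight I j * ((budget I j)%:R * point p j)).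
  apply: represents_rmul => //; apply: represents_rmul; last exact: represents_point.
  by rewrite -hg; apply: represents_rnat.
have := represents_foldr (fun=> true) (enum 'I_N) hF represents_rzero.
rewrite addr0 big_enum /=; under eq_bigr do rewrite mulr1; exact.
Qed.

Definition excess_entry (p : seq ratc) (x : {ffun 'I_n -> bool}) (j : 'I_N) i : ratc :=
  if x i then rmax0 (rsub (rsub (hi j i) (lo j i)) (nth rzero p j)) else rzero.

Lemma excessesE p (x : {ffun 'I_n -> bool}) : p \in tuples ds ->
  excesses ds p [seq x i | i <- enum 'I_n] =
  [seq [seq excess_entry p x j i | i <- enum 'I_n] | j : 'I_N <- enum 'I_N].
Proof.
move=> hp; rewrite /excesses [in LHS](tuple_nth hp) zip_map -map_comp.
apply: eq_map => j /=; rewrite deviations_data_of zip_map -map_comp.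
exact: eq_map.
Qed.

Lemma represents_excess_entry p x j i : p \in tuples ds ->
  represents (excess_entry p x j i) (excess I (point p) j i * (x i)%:R).
Proof.
move=> hp; rewrite /excess_entry; case: (x i); last first.
  by rewrite mulr0; apply: represents_rzero.
rewrite mulr1; apply: represents_rmax0; apply: represents_rsub.
  exact: represents_deviation.
exact: represents_point.
Qed.

(** The solutions [x k] are arbitrary nominal optima, since nothing more is known of the solver's
    answers. *)
Lemma robust_output_solution (R : realFieldType) m (tp : 'I_m -> seq ratc)
    (x : 'I_m -> {ffun 'I_n -> bool}) :
  tuples ds = [seq tp k | k <- enum 'I_m] ->
  (forall k, nominal_optimal (reduced_instance I (point (tp k))) (x k)) ->
  bwrp_solution R I
    (enc (robust_output ds [seq [seq x k i | i <- enum 'I_n] | k <- enum 'I_m])).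
Proof.
move=> tpE xopt.
have tpin k : tp k \in tuples ds.
  by rewrite tpE; apply/mapP; exists k; rewrite ?mem_enum.
have tp_breakpoints b : breakpoints I b -> exists k, point (tp k) =1 b.
  by move=> /breakpoints_point[p]; rewrite tpE => /mapP[k _ ->]; exists k.
pose value k := robust_value ds (tp k) [seq x k i | i <- enum 'I_n].
pose out k : outcome := (value k, (tp k, [seq x k i | i <- enum 'I_n])).
have hvalue k : represents (value k) (reduced_value I (point (tp k)) (x k)).
  exact: represents_robust_value.
have outE : outcomes ds [seq [seq x k i | i <- enum 'I_n] | k <- enum 'I_m] =
    [seq out k | k <- enum 'I_m].
  by rewrite /outcomes tpE zip_map -map_comp.
(* The zero tuple is always a candidate, so there is an outcome to choose. *)
have [k0 _] : exists k, point (tp k) =1 (fun=> 0) by apply: tp_breakpoints => j; left.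
have m0 : (0 < m)%N by apply: leq_ltn_trans (ltn_ord k0).
have [||] := @best_min [seq out k | k <- enum 'I_m].
- by rewrite size_map size_enum_ord.
- by apply/allP => _ /mapP[k _ ->]; have [] := hvalue k.
move=> /mapP[k _ bE] bmin.
have {}bmin k' : reduced_value I (point (tp k)) (x k) <=
    reduced_value I (point (tp k')) (x k').
  have := bmin (out k'); rewrite bE => /(_ (map_f _ _)).
  rewrite mem_enum => /(_ isT) /=.
  by have [_ <-] := hvalue k; have [_ <-] := hvalue k'.
rewrite /robust_output outE bE /=; have [xX _] := xopt k.
have p0 j : 0 <= point (tp k) j.
  have [->|[i ->]] := point_breakpoints (tpin k) j; first by [].
  exact: deviation_ge0.
exists (x k), (point (tp k)), (fun j i => excess I (point (tp k)) j i * (x k i)%:R).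
split.
  split; first exact: reduced_feasible.
  move=> y p rho yf; rewrite reduced_bwrp_value.
  (* The chain of inequalities: the chosen outcome is at most the outcome for the tuple of [b],
     which by nominal optimality is at most [reduced_value I b y]. The budget term does not depend
     on the 0-1 vector and cancels. *)
  have [b hb] := reduced_value_le yf; apply: le_trans; rewrite ler_rat.
  have [k' k'b] := tp_breakpoints b hb; apply: le_trans (bmin k') _.
  have -> : reduced_value I b y = reduced_value I (point (tp k')) y.
    congr (_ + _); apply: eq_bigr => i _; last by rewrite k'b.
    by congr (_ * _); apply: eq_bigr => j _; rewrite /excess k'b.
  rewrite lerD2r; have [_] := xopt k'; apply.
  by case: yf.
exists (enc [seq x k i | i <- enum 'I_n]), (enc (tp k,
  excesses ds (tp k) [seq x k i | i <- enum 'I_n])); split=> //.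
  exact: vec_code_enc.
exists (enc (tp k)), (enc (excesses ds (tp k) [seq x k i | i <- enum 'I_n])).
split=> //.
  rewrite [X in enc X](tuple_nth (tpin k)); apply: vec_code_enc => j.
  by apply/rat_codeE; exists (nth rzero (tp k) j) => //; apply: represents_point.
rewrite excessesE //; apply: vec_code_enc => j; apply: vec_code_enc => i.
apply/rat_codeE; exists (excess_entry (tp k) (x k) j i) => //.
exact: represents_excess_entry.
Qed.

End AlgorithmCorrect.
Local Close Scope ring_scope.

(** * Calling the nominal solver *)

Record solver_run (c : cmd) (q : {poly nat}) := SolverRun {
  run_input : tree;
  run_output : natc;
  run_exec : exists k s, [/\ exec c (init run_input) k s,
    k <= (q.[tree_size run_input])%R & s 0 = enc run_output]
}.

(** A run is encoded by its input alone, so computing [run_output] from the code means executing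
    [c]. The output has type [natc] because 0-1 vectors, too, are lists of bits. *)
#[export] Instance enc_solver_run c q : Enc (solver_run c q) :=
  fun r => run_input r.

(** Indexing the algorithm by the solver runs it will make turns the solver,
    which is only specified on codes of instances, into a function. *)
Record robust_run (N : nat) (c : cmd) (q : {poly nat}) := RobustRun {
  robust_input : tree * N.-tuple data;
  robust_runs : seq (solver_run c q);
  robust_runsE : [seq run_input r | r <- robust_runs] =
    [seq enc (robust_input.1, cost_vector robust_input.2 p)
    | p <- tuples robust_input.2]
}.

#[export] Instance enc_robust_run N c q : Enc (robust_run N c q) :=
  fun r => enc (robust_input r).

Lemma polybound_horner (q : {poly nat}) : polybound (fun n => q.[n]%R).
Proof.
elim/poly_ind: q => [|q a IH].
  by exists 0 => n _; rewrite horner0.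
apply: (@polybound_leq (fun n => q.[n]%R * n + a)); first by polybound.
by move=> n _; rewrite hornerMXaddC.
Qed.

Lemma ptime_run_output c q : ptime (fun r : solver_run c q => run_output r).
Proof.
have [m cm] := cmd_bound c.
(* The successor ensures that variable 0, the output, is among those whose final values [runs_frame]
   describes. *)
have cm1 : cmd_below m.+1 c by apply: cmd_belowS cm.
apply: (@ptime_intro _ _ _ _ _ (Seq (clear_vars m.+1) c) m.+1
  (fun n => m.+1 * 4 + q.[n]%R + 2)).
  by polybound; apply: polybound_horner.
move=> s r sr; have [k [s1 [ex lek s1E]]] := run_exec r.
have ex' : exec c (init (s 0)) k s1 by rewrite sr.
apply: runs_weaken (runs_frame cm1 ex') _ _; first by rewrite addn2 !ltnS leq_add2l.
by move=> s' [h1 h2]; split; [rewrite h1|exact: h2].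
Qed.

Lemma ptime_robust_run N c q : ptime (fun r : robust_run N c q =>
  robust_output (robust_input r).2 (map (@run_output c q) (robust_runs r))).
Proof.
have pin : ptime (fun r : robust_run N c q => robust_input r).
  exact: ptime_recode ptime_id.
(* By [robust_runsE] the list of runs has the same code as the list of reduced instances, so it
   suffices to compute the latter. *)
have pruns : ptime (fun r : robust_run N c q => robust_runs r).
  apply: (ptime_recode (h := @robust_input N c q) (f := fun a =>
    [seq (a.1, cost_vector a.2 p) | p <- tuples a.2])) => // [r|].
    by rewrite /enc /= /enc_seq robust_runsE -map_comp.
  ptime; last by apply: (ptime_comp _ (@ptime_tuples N)); ptime.
  apply: (ptime_comp (f := fun q => (q.1.2, q.2)) _ (@ptime_cost_vector N)).
  by ptime.
apply: (ptime_comp (f := fun r => ((robust_input r).2,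
  map (@run_output c q) (robust_runs r))) _ (@ptime_robust_output N)).
ptime; apply: (ptime_comp _ (@ptime_run_output c q)); ptime.
Qed.

Lemma bwrp_codeE (C : nominal_class) N (I : bwrp_instance C N) t : bwrp_code I t ->
  exists w g lo hi,
  [/\ t = enc (encoding (rob_set I), [seq data_of w g lo hi j | j <- enum 'I_N]),
      forall j, represents (w j) (weight I j),
      forall j, binary_value (g j) = budget I j,
      forall j i, represents (lo j i) (cost_lo I j i)
    & forall j i, represents (hi j i) (cost_hi I j i)].
Proof.
move=> [_ [u [-> -> hu]]].
pose n := Defs.dim (rob_set I).
pose P (j : 'I_N) (d : data) := exists lo hi : 'I_n -> ratc,
  [/\ represents d.1 (weight I j), binary_value d.2.1 = budget I j,
      d.2.2 = ([seq lo i | i <- enum 'I_n], [seq hi i | i <- enum 'I_n]),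
      forall i, represents (lo i) (cost_lo I j i)
    & forall i, represents (hi i) (cost_hi I j i)].
have [|d -> /fin_all_exists[lo /fin_all_exists[hi hd]]] := vec_codeE (P := P) _ hu.
  move=> j _ [_ [_ [-> /rat_codeE[w -> hw]
    [_ [_ [-> [s -> hg] [tlo [thi [-> hlo hhi]]]]]]]]].
  have [|lo -> hlo'] := vec_codeE (P := fun i r => represents r (cost_lo I j i)) _ hlo.
    by move=> i r /rat_codeE.
  have [|hi -> hhi'] := vec_codeE (P := fun i r => represents r (cost_hi I j i)) _ hhi.
    by move=> i r /rat_codeE.
  exists (w, (s, ([seq lo i | i <- enum 'I_n], [seq hi i | i <- enum 'I_n]))) => //.
  by exists lo, hi.
exists (fun j => (d j).1), (fun j => (d j).2.1), lo, hi.
split=> [|j|j|j|j]; try by have [] := hd j.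
congr (enc (_, _)); apply: eq_map => j; have [_ _ E _ _] := hd j.
by rewrite /data_of -E -!surjective_pairing.
Qed.

Theorem theorem2 (R : realFieldType) (N : nat) (N_ge1 : (1 <= N)%N)
    (C : nominal_class) :
  nominal_poly_time C -> bwrp_poly_time R C N.
Proof.
move=> [c0 [q0 solve]].
have [c [m [d hc]]] := ptime_robust_run N c0 q0.
exists c, (('X + 1) ^+ d)%R => I t /bwrp_codeE[w [g [lo [hi [tE hw hg hlo hhi]]]]].
set n := Defs.dim (rob_set I) in lo hi tE hlo hhi.
set ds := [seq data_of w g lo hi j | j <- enum 'I_N] in tE.
have solved p : p \in tuples ds -> exists r : solver_run c0 q0,
    run_input r = enc (encoding (rob_set I), cost_vector ds p) /\
    exists2 x : {ffun 'I_n -> bool},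
      nominal_optimal (reduced_instance I (point p)) x &
      run_output r = [seq x i | i <- enum 'I_n].
  move=> hp; move uE : (enc _) => u.
  have code : nominal_code (reduced_instance I (point p)) u.
    exists (encoding (rob_set I)), (enc (cost_vector ds p)); split=> //.
    rewrite (cost_vectorE N_ge1 hp); apply: vec_code_enc => i; apply/rat_codeE.
    exists (cost_entry w lo hi p i) => //.
    exact: (represents_cost_entry hw hlo hhi i hp).
  have [k [s [ex lek [x xopt xcode]]]] := solve _ _ code.
  (* The code of a 0-1 vector is unique, so the solver's answer is the encoding of a list of bits,
     as [solver_run] requires. *)
  have sE : s 0 = enc [seq x i | i <- enum 'I_n].
    case: xcode => b -> hb; rewrite /enc /enc_seq -map_comp.
    by congr list_tree; apply: eq_map => i /=; rewrite hb.
  have run : exists k s, [/\ exec c0 (init u) k s, k <= (q0.[tree_size u])%R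
    & s 0 = enc [seq x i | i <- enum 'I_n]] by exists k, s.
  by exists (SolverRun run); split=> //; exists x.
pose tp k := tnth (in_tuple (tuples ds)) k.
have tuplesE : tuples ds = [seq tp k | k <- enum 'I_(size (tuples ds))].
  by rewrite map_tnth_enum.
(* There are finitely many tuples, so finite choice selects the runs, and then the optima they
   return. *)
have /fin_all_exists[run hrun] k := solved (tp k) (mem_tnth k (in_tuple (tuples ds))).
have /fin_all_exists2[x xopt xout] k := (hrun k).2.
pose dst := [tuple data_of w g lo hi j | j < N].
have runsE : [seq run_input r | r <- [seq run k | k <- enum 'I_(size (tuples ds))]] =
    [seq enc (encoding (rob_set I), cost_vector dst p) | p <- tuples dst].
  rewrite -[tuples dst]/(tuples ds) [in RHS]tuplesE -!map_comp; apply: eq_map => k /=.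
  by have [] := hrun k.
(* The program [c] and the exponent [d] were fixed before the instance; only the index [r] depends
   on it, and the code of [r] is the input [t] itself. *)
pose r := @RobustRun N c0 q0 (encoding (rob_set I), dst) _ runsE.
have [|k [s [ex lek [sE _]]]] := hc (init t) r; first by rewrite tE.
exists k, s; split=> //.
  have -> : ((('X + 1) ^+ d).[tree_size t])%R = (tree_size t).+1 ^ d.
    by rewrite horner_exp hornerD hornerX hornerC natrXE; congr (_ ^ _); apply: addn1.
  by rewrite tE.
rewrite sE /= -map_comp (eq_map (g := fun k => [seq x k i | i <- enum 'I_n])) //.
exact: (robust_output_solution N_ge1 hw hg hlo hhi R tuplesE xopt).
Qed.
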